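(* Let $q$ be a left-invariant pseudo-Riemannian metric on $\mathrm{SL}(2,\mathbb{R})$ whose associated isomorphism $\Phi$ has two non-real eigenvalues, with Lax vector field $$E=b(z_2^2+z_3^2)\frac{\partial}{\partial z_1}+z_1(az_3-bz_2)\frac{\partial}{\partial z_2}+z_1(az_2+bz_3)\frac{\partial}{\partial z_3}$$ on $\mathbb{R}^3$, and assume $a\neq0$ and $b>0$. Let $L\subset\mathbb{R}^3\setminus\{0\}$ be a trajectory of $E$. The geodesic associated with $L$ is complete if $L$ is contained in the invariant plane $\{z_2=\frac{-b-\sqrt{a^2+b^2}}{a}\,z_3\}$ and incomplete in all the other cases. An incomplete geodesic is $\mathbb{R}^+$-complete or $\mathbb{R}^-$-complete if and only if $L$ is contained in the invariant plane $\{z_2=\rho_2z_3\}$, where $\rho_2=\frac{-b+\sqrt{a^2+b^2}}{a}$, and the projection of $L$ under $(z_1,z_2,z_3)\mapsto[z_1:z_2:z_3]\in\mathbb{RP}(2)$ does not coincide with the (open) line segment $\{[x_1:\rho_2:1]:\ -\rho_1<x_1<\rho_1\}$ joining $p_1=[\rho_1:\rho_2:1]$ and $p_2=[-\rho_1:\rho_2:1]$, where $\rho_1=\sqrt{2b(-b+\sqrt{a^2+b^2})}/|a|$.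
   Context: Let $B(x,y)=2\,\mathrm{Tr}(xy)$ on $\mathfrak{sl}(2,\mathbb{R})$ (one half of the Killing form). The associated isomorphism of $q$ is the unique $B$-self-adjoint linear isomorphism $\Phi$ with $q(x,y)=B(\Phi x,y)$. When $\Phi$ has two non-real eigenvalues, one fixes a basis $(v_1,v_2,v_3)$ with $B(v_1,v_1)=B(v_2,v_2)=-B(v_3,v_3)=1$, $B(v_i,v_j)=0$ for $i\ne j$, $[v_1,v_2]=v_3$, $[v_1,v_3]=v_2$, $[v_2,v_3]=-v_1$, and $\Phi^{-1}v_1=\eta v_1$, $\Phi^{-1}v_2=\gamma_0v_2-\zeta v_3$, $\Phi^{-1}v_3=\zeta v_2+\gamma_0v_3$ with $\eta\neq 0$, $\zeta\ne0$; put $a=\gamma_0-\eta$, $b=\zeta$, and let $(z_1,z_2,z_3)$ be the coordinates of $z\in\mathfrak{sl}(2,\mathbb{R})$ in this basis. A curve $\gamma$ is a geodesic of $q$ iff $z(t)=\Phi(\gamma(t)^{-1}\dot\gamma(t))$ solves $\dot z=[z,\Phi^{-1}z]$, i.e. is an integral curve of $E$; maximal geodesics and corresponding maximal integral curves have the same interval of definition, and the geodesic associated with a trajectory $L$ is the one so corresponding to it. A geodesic is complete if its maximal interval of definition is $\mathbb{R}$, and $\mathbb{R}^+$-complete (resp. $\mathbb{R}^-$-complete) if this interval is unbounded above (resp. below). *)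

(* Defs.v *)
From HB Require Import structures.
From mathcomp Require Import all_boot all_order all_algebra.
From mathcomp Require Import complex.
From mathcomp Require Import all_classical all_reals all_analysis.
Set Implicit Arguments.
Unset Strict Implicit.
Unset Printing Implicit Defensive.
Import Order.TTheory GRing.Theory Num.Theory.
Import numFieldNormedType.Exports.
Local Open Scope classical_set_scope.
Local Open Scope ring_scope.

Section LieAlgebra.
Context {R : realType}.

Definition sl2_space : {vspace 'M[R]_2} :=
  lker (linfun (mxtrace : 'M[R]_2 -> R^o)).

Definition sl2 := subvs_of sl2_space.

(* The commutator is traceless, so the projection vsproj does not alter it. *)
Definition bracket (x y : sl2) : sl2 :=
  vsproj sl2_space (vsval x *m vsval y - vsval y *m vsval x).

Definition B (x y : sl2) : R := 2%:R * \tr (vsval x *m vsval y).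

(* A left-invariant pseudo-Riemannian metric is identified with its value at
   the unit matrix: the metric at g in SL(2,R) sends the tangent vectors g *m u
   and g *m v to q u v. *)
Definition pseudo_euclidean (q : {biscalar sl2}) : Prop :=
  (forall x y, q x y = q y x) /\
  (forall x, (forall y, q x y = 0) -> x = 0).

Definition associated_isomorphism (q : {biscalar sl2}) (Phi : 'End(sl2)) :=
  [/\ lker Phi = 0%VS,
      forall x y, B (Phi x) y = B x (Phi y) &
      forall x y, q x y = B (Phi x) y].

Definition complex_eigenvalue (Phi : 'End(sl2)) (l : R[i]) : bool :=
  let e := vbasis {:sl2} in
  eigenvalue (map_mx (real_complex R) (passmx.mxof e e Phi)) l.

Definition two_nonreal_eigenvalues (Phi : 'End(sl2)) : Prop :=
  exists l m : R[i],
    [/\ l != m, complex.Im l != 0, complex.Im m != 0,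
        complex_eigenvalue Phi l & complex_eigenvalue Phi m].

Definition normal_basis (Phi : 'End(sl2)) (v1 v2 v3 : sl2)
    (eta gamma0 zeta : R) : Prop :=
  basis_of {:sl2} [:: v1; v2; v3] /\
  [/\ B v1 v1 = 1, B v2 v2 = 1 & B v3 v3 = -1] /\
  [/\ B v1 v2 = 0, B v1 v3 = 0 & B v2 v3 = 0] /\
  [/\ bracket v1 v2 = v3, bracket v1 v3 = v2 & bracket v2 v3 = - v1] /\
  [/\ (Phi^-1)%VF v1 = eta *: v1,
      (Phi^-1)%VF v2 = gamma0 *: v2 - zeta *: v3 &
      (Phi^-1)%VF v3 = zeta *: v2 + gamma0 *: v3] /\
  eta != 0 /\ zeta != 0.

(* D x y is the covariant derivative of the left-invariant field y along the
   left-invariant field x: torsion-free, and metric since q x y is constant. *)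
Definition levi_civita (q : {biscalar sl2})
    (D : {bilinear sl2 -> sl2 -> sl2}) : Prop :=
  (forall x y, D x y - D y x = bracket x y) /\
  (forall x y w, q (D x y) w + q y (D x w) = 0).

End LieAlgebra.
Arguments sl2 R : clear implicits.

Section Curves.
Context {R : realType}.

Definition open_interval (I : set R) : Prop :=
  [/\ I !=set0, open I & is_interval I].

Definition maximal {T : Type} (P : set R -> (R -> T) -> Prop)
    (I : set R) (c : R -> T) : Prop :=
  P I c /\
  forall J d, P J d -> I `<=` J -> (forall t, I t -> c t = d t) -> J = I.

(* gamma^-1 gamma'; for a differentiable curve in SL(2,R) this matrix is
   traceless, so the projection vsproj does not alter it. *)
Definition velocity (gamma : R -> 'M[R]_2) (t : R) : sl2 R :=
  vsproj sl2_space (invmx (gamma t) *m derive1 gamma t).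

(* In the left-invariant frame the covariant derivative of gamma' along gamma
   is x' + D x x, where x = gamma^-1 gamma'. *)
Definition geodesic (D : sl2 R -> sl2 R -> sl2 R)
    (I : set R) (gamma : R -> 'M[R]_2) : Prop :=
  open_interval I /\
  forall t, I t ->
    let x := velocity gamma in
    [/\ \det (gamma t) = 1, derivable gamma t 1,
        derivable (fun s => vsval (x s)) t 1 &
        derive1 (fun s => vsval (x s)) t + vsval (D (x t) (x t)) = 0].

Definition vec3 (x y z : R) : 'rV[R]_3 := \row_i [:: x; y; z]`_i.
Definition z1 (z : 'rV[R]_3) : R := z ord0 (inord 0).
Definition z2 (z : 'rV[R]_3) : R := z ord0 (inord 1).
Definition z3 (z : 'rV[R]_3) : R := z ord0 (inord 2).

Definition coords (v1 v2 v3 : sl2 R) (x : sl2 R) : 'rV[R]_3 :=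
  \row_i coord [tuple v1; v2; v3] i x.

Definition lax_field (a b : R) (z : 'rV[R]_3) : 'rV[R]_3 :=
  vec3 (b * (z2 z ^+ 2 + z3 z ^+ 2))
       (z1 z * (a * z3 z - b * z2 z))
       (z1 z * (a * z2 z + b * z3 z)).

Definition integral_curve (E : 'rV[R]_3 -> 'rV[R]_3)
    (I : set R) (z : R -> 'rV[R]_3) : Prop :=
  open_interval I /\ forall t, I t -> derivable z t 1 /\ derive1 z t = E (z t).

Definition trajectory (E : 'rV[R]_3 -> 'rV[R]_3) (L : set 'rV[R]_3) : Prop :=
  exists I z, maximal (integral_curve E) I z /\ L = z @` I.

(* Unique up to a left translation of SL(2,R) and a shift of the parameter. *)
Definition associated_geodesic (D : sl2 R -> sl2 R -> sl2 R)
    (Phi : 'End(sl2 R)) (v1 v2 v3 : sl2 R) (L : set 'rV[R]_3)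
    (I : set R) (gamma : R -> 'M[R]_2) : Prop :=
  maximal (geodesic D) I gamma /\
  (fun t => coords v1 v2 v3 (Phi (velocity gamma t))) @` I = L.

Definition geodesically_complete (I : set R) : Prop := I = setT.
Definition Rplus_complete (I : set R) : Prop := ~ has_ubound I.
Definition Rminus_complete (I : set R) : Prop := ~ has_lbound I.

(* A point of RP(2) is a line of R^3: [z1 : z2 : z3] is the span of z. *)
Definition rp2_point (z : 'rV[R]_3) : {vspace 'rV[R]_3} := <[z]>%VS.

End Curves.

(* Main.v *)
From HB Require Import structures.
From mathcomp Require Import all_boot all_order all_algebra.
From mathcomp Require Import ring lra.
From mathcomp Require Import all_classical all_reals all_analysis.
Require Import Defs.
Set Implicit Arguments.
Unset Strict Implicit.
Unset Printing Implicit Defensive.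
Import Order.TTheory GRing.Theory Num.Theory.
Import numFieldNormedType.Exports.
Local Open Scope classical_set_scope.
Local Open Scope ring_scope.

(** In the left-invariant frame a geodesic is a solution of gamma' = gamma X(z),
    z' = E(z), with X linear: a homogeneous quadratic system. The power series
    solving such a system has a radius of convergence that depends only on a
    bound for the initial value, and gamma may be normalised to the unit matrix
    by a left translation; so a maximal geodesic is defined on an interval of
    uniform length around every time at which z lies in a given ball.

    The symmetric matrix [[-b, a], [a, b]] has eigenvalues r and -r; let U and V
    be linear forms in (z2, z3) vanishing on the planes z2 = (-b-r)/a z3 and
    z2 = (-b+r)/a z3. Then U' = r z1 U, V' = - r z1 V, and UV is conserved.
    - If U = 0, then r z1^2 + b (z2^2 + z3^2) is conserved, z is bounded and the
      geodesic is complete.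
    - If UV <> 0, energy conservation gives z1' >= e (1 + z1^2) for some e > 0,
      so that arctan z1 grows at least linearly and time is bounded on both
      sides.
    - If V = 0 and U <> 0, then z1' = r (z1^2 - h) with h = z1^2 - rho1^2 z3^2
      conserved. For h < 0 time is again bounded on both sides, and z1 runs
      over the whole line, so z1 / z3 runs over ]-rho1, rho1[. For h >= 0, z1
      never vanishes, moves away from 0 up to infinity in finite time on one
      side and stays bounded on the other. *)

(** * Differential calculus on intervals *)

Section PointwiseDerivatives.
Context {R : realType}.
Implicit Types (f g : R -> R) (t d e : R).

Lemma der_cst (c t : R) : is_derive t 1 (fun=> c) 0.
Proof. exact: is_derive_cst. Qed.

Lemma der_id t : is_derive t 1 (fun x => x) 1.
Proof. exact: is_derive_id. Qed.

Lemma derD f g t d e : is_derive t 1 f d -> is_derive t 1 g e ->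
  is_derive t 1 (fun x => f x + g x) (d + e).
Proof. by move=> ? ?; exact: is_deriveD. Qed.

Lemma derN f t d : is_derive t 1 f d -> is_derive t 1 (fun x => - f x) (- d).
Proof. by move=> ?; exact: is_deriveN. Qed.

Lemma derM f g t d e : is_derive t 1 f d -> is_derive t 1 g e ->
  is_derive t 1 (fun x => f x * g x) (f t * e + g t * d).
Proof. by move=> ? ?; exact: is_deriveM. Qed.

Lemma derX f n t d : is_derive t 1 f d ->
  is_derive t 1 (fun x => f x ^+ n) (n%:R * f t ^+ n.-1 * d).
Proof. by move=> ?; rewrite -exprfctE; exact: is_deriveX. Qed.

Lemma der_eq f t d e : is_derive t 1 f d -> d = e -> is_derive t 1 f e.
Proof. by move=> h <-. Qed.

Lemma der_sum (I : Type) (s : seq I) (F : I -> R -> R) (dF : I -> R) t :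
  (forall i, is_derive t 1 (F i) (dF i)) ->
  is_derive t 1 (fun x => \sum_(i <- s) F i x) (\sum_(i <- s) dF i).
Proof.
move=> h; elim: s => [|i s IH].
  rewrite big_nil; have -> : (fun x => \sum_(i <- [::]) F i x) = cst 0.
    by apply/funext => x; rewrite big_nil.
  exact: der_cst.
rewrite big_cons.
have -> : (fun x => \sum_(i <- i :: s) F i x) =
          (fun x => F i x + \sum_(i <- s) F i x).
  by apply/funext => x; rewrite big_cons.
exact: derD.
Qed.

Lemma der_comp f g t d e : is_derive t 1 g e -> is_derive (g t) 1 f d ->
  is_derive t 1 (fun x => f (g x)) (e * d).
Proof. by move=> hg hf; rewrite mulrC; exact: (is_derive1_comp hf hg). Qed.

Lemma der_continuous f t d : is_derive t 1 f d -> {for t, continuous f}.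
Proof. by move=> [h _]; exact/differentiable_continuous/derivable1_diffP. Qed.

End PointwiseDerivatives.

(** Differentiation follows the syntax of the function, with the hypotheses in context tried first.
    [der] then leaves only the algebraic comparison with the expected derivative. *)
Ltac der_step := first [eassumption | lazymatch goal with
  | |- is_derive _ _ (fun x => @?f x ^+ _) _ => notypeclasses refine (@derX _ f _ _ _ _)
  | |- is_derive _ _ (fun x => @?f x * @?g x) _ => notypeclasses refine (@derM _ f g _ _ _ _ _)
  | |- is_derive _ _ (fun x => @?f x + @?g x) _ => notypeclasses refine (@derD _ f g _ _ _ _ _)
  | |- is_derive _ _ (fun x => - @?f x) _ => notypeclasses refine (@derN _ f _ _ _)
  | |- is_derive _ _ (fun=> ?c) _ => notypeclasses refine (der_cst c _)
  | |- is_derive _ _ (fun x => x) _ => notypeclasses refine (der_id _)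
  end].

Ltac der := notypeclasses refine (der_eq _ _); [repeat der_step | rewrite /=].

Section Interval.
Context {R : realType}.
Variable I : set R.
Hypothesis iI : is_interval I.
Implicit Types (f df : R -> R).

Lemma interval_MVT f df : (forall t, I t -> is_derive t 1 f (df t)) ->
  forall s t, I s -> I t -> s <= t ->
  exists2 c, s <= c <= t & f t - f s = df c * (t - s).
Proof.
move=> hf s t Is It st.
have sub x : s <= x <= t -> I x by move=> ?; exact: (iI Is It).
have [||c] := @MVT_segment R f df s t st.
- move=> x; rewrite in_itv/= => /andP[h1 h2]; apply: hf.
  by apply: sub; rewrite !ltW.
- apply: derivable_within_continuous => x; rewrite in_itv/= => h.
  by have [] := hf x (sub _ h).
by rewrite in_itv/= => ? ?; exists c.
Qed.

Lemma interval_homo f df : (forall t, I t -> is_derive t 1 f (df t)) ->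
  forall s t, I s -> I t -> s <= t ->
  (forall x, s <= x <= t -> 0 <= df x) -> f s <= f t.
Proof.
move=> hf s t Is It st h; have [c hc e] := interval_MVT hf Is It st.
by rewrite -subr_ge0 e mulr_ge0 ?subr_ge0 ?h.
Qed.

Lemma interval_const f : (forall t, I t -> is_derive t 1 f 0) ->
  forall s t, I s -> I t -> f s = f t.
Proof.
move=> hf; suff H s t : I s -> I t -> s <= t -> f s = f t.
  by move=> s t Is It; case/orP: (le_total s t) => ?; [|symmetry]; exact: H.
move=> Is It st; have [c _] := interval_MVT hf Is It st.
by rewrite mul0r => /subr0_eq ->.
Qed.

(** On the segment between [t0] and [t] the continuous function [k] has a maximum K. Forward in time
    s exp(-K x) is nonincreasing, backward in time s exp(K x) is nondecreasing as a function of x;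
    both vanish at [t0], and s is nonnegative. *)
Lemma gronwall_eq0 (s ds k : R -> R) :
  (forall t, I t -> is_derive t 1 s (ds t)) ->
  (forall t, I t -> {for t, continuous k}) ->
  (forall t, I t -> 0 <= s t) ->
  (forall t, I t -> `|ds t| <= k t * s t) ->
  forall t0 t, I t0 -> I t -> s t0 = 0 -> s t = 0.
Proof.
move=> hs ck s0 hk t0 t It0 It st0.
have bnd x y : I x -> I y -> x <= y ->
    exists K, forall z, x <= z <= y -> `|ds z| <= K * s z.
  move=> Ix Iy xy; have sub z : x <= z <= y -> I z by exact: (iI Ix Iy).
  have [|c _ hc] := @EVT_max R k x y xy.
    apply: continuous_in_subspaceT => z.
    by rewrite inE/= in_itv/= => /sub; exact: ck.
  exists (k c) => z hz; apply: (le_trans (hk _ (sub _ hz))).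
  by apply: ler_wpM2r; [exact/s0/sub|apply: hc; rewrite in_itv].
have dh K z : I z -> is_derive z 1 (fun x => s x * expR (K * x))
    ((ds z + K * s z) * expR (K * z)).
  move=> Iz; have ? := hs _ Iz.
  have ? : is_derive z 1 (fun x => expR (K * x)) (K * expR (K * z)).
    have h : is_derive z 1 (fun x => K * x) K by der; ring.
    exact: (der_comp h (is_derive_expR _)).
  by der; ring.
apply/eqP; rewrite eq_le s0// andbT.
case/orP: (le_total t0 t) => le.
- have [K hK] := bnd _ _ It0 It le.
  rewrite -(pmulr_lle0 _ (expR_gt0 (- K * t))).
  suff : - (s t0 * expR (- K * t0)) <= - (s t * expR (- K * t)).
    by rewrite st0 mul0r oppr0 oppr_ge0 mulrC.
  apply: (@interval_homo (fun x => - (s x * expR (- K * x))) _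
    (fun z Iz => derN (dh (- K) z Iz)) _ _ It0 It le) => x hx.
  rewrite -mulNr mulr_ge0 ?expR_ge0//.
  by have := hK x hx; rewrite ler_norml => /andP[]; lra.
- have [K hK] := bnd _ _ It It0 le.
  rewrite -(pmulr_lle0 _ (expR_gt0 (K * t))).
  suff : s t * expR (K * t) <= s t0 * expR (K * t0) by rewrite st0 mul0r.
  apply: (interval_homo (dh K) It It0 le) => x hx.
  rewrite mulr_ge0 ?expR_ge0//.
  by have := hK x hx; rewrite ler_norml => /andP[]; lra.
Qed.

Lemma interval_IVT f : (forall t, I t -> {for t, continuous f}) ->
  forall s t y, I s -> I t -> f s <= y <= f t -> exists2 c, I c & f c = y.
Proof.
move=> cf s t y Is It /andP[sy yt].
have cont x z : I x -> I z -> {within `[x, z], continuous f}.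
  move=> Ix Iz; apply: continuous_in_subspaceT => w.
  by rewrite inE/= in_itv/= => h; apply: cf; exact: (iI Ix Iz).
have fst : f s <= f t by exact: le_trans yt.
case/orP: (le_total s t) => st.
- have [|c] := IVT st (cont _ _ Is It) (v := y).
    by rewrite (min_idPl _)// (max_idPr _)// sy.
  by rewrite in_itv/= => h ?; exists c => //; exact: (iI Is It).
- have [|c] := IVT st (cont _ _ It Is) (v := y).
    by rewrite (min_idPr _)// (max_idPl _)// sy.
  by rewrite in_itv/= => h ?; exists c => //; exact: (iI It Is).
Qed.

Lemma interval_sign f : (forall t, I t -> {for t, continuous f}) ->
  (forall t, I t -> f t != 0) -> forall s t, I s -> I t -> 0 < f s -> 0 < f t.
Proof.
move=> cf f0 s t Is It fs; rewrite ltNge; apply/negP => ft.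
have [|c Ic fc] := interval_IVT cf It Is (y := 0); first by rewrite ft ltW.
by have := f0 _ Ic; rewrite fc eqxx.
Qed.

(** The derivative of atan f is at least [e], while atan takes its values in an interval of length
    [pi]. *)
Lemma riccati_blowup f df (e : R) :
  (forall t, I t -> is_derive t 1 f (df t)) ->
  forall s t, I s -> I t -> s <= t ->
  (forall x, s <= x <= t -> e * (1 + f x ^+ 2) <= df x) -> e * (t - s) <= pi.
Proof.
move=> hf s t Is It st h.
have hg x : I x -> is_derive x 1 (fun x => atan (f x)) (df x * (1 + f x ^+ 2)^-1).
  by move=> Ix; exact: (der_comp (hf _ Ix) (is_derive1_atan _)).
have [c hc e1] := interval_MVT hg Is It st.
have : atan (f t) - atan (f s) <= pi.
  by have := atan_ltpi2 (f t); have := atan_gtNpi2 (f s); lra.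
apply: le_trans; rewrite e1 ler_wpM2r ?subr_ge0// ler_pdivlMr ?h//.
by rewrite ltr_pwDl// sqr_ge0.
Qed.

End Interval.

(** * Quadratic differential equations *)

Section QuadraticODE.
Context {R : realType}.

Lemma cvg_series_geometric_bound (u : nat -> R) (A : R) :
  (forall n, `|u n| <= A * 2^-1 ^+ n) -> cvgn (series u).
Proof.
move=> hu; apply: normed_cvg.
have A0 : 0 <= A by have := hu 0; rewrite expr0 mulr1; apply: le_trans.
apply: (@series_le_cvg R (fun n => `|u n|) (geometric A 2^-1)) => //.
  by move=> n /=; rewrite mulr_ge0// exprn_ge0// invr_ge0.
apply: is_cvg_geometric_series.
by rewrite ger0_norm ?invr_ge0// invf_lt1 ?ltr1n.
Qed.

Lemma series_conv (f g : nat -> R) N :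
  series (fun n => \sum_(p < n.+1) f p * g (n - p)%N) N =
  \sum_(i < N) f i * \sum_(j < N - i) g j.
Proof.
elim: N => [|N IH]; first by rewrite /series/= big_geq// big_ord0.
rewrite seriesSr IH.
rewrite big_ord_recr [RHS]big_ord_recr/= subnn subSn// subnn.
rewrite (big_ord_recr 0) big_ord0 /= add0r addrA; congr (_ + _).
rewrite -big_split/=; apply: eq_bigr => i _.
by rewrite subSn 1?ltnW// big_ord_recr/= mulrDr.
Qed.

(** Mertens' theorem with explicit bounds. The product of the partial sums exceeds that of the
    Cauchy product by the terms with i, j < N <= i + j: at most N^2 of them, each bounded by A^2 /
    8^N. As N^2 <= 4^N, the difference is at most A^2 / 2^N. *)
Lemma cvg_series_conv (f g : nat -> R) (A : R) :
  (forall n, `|f n| <= A * 8^-1 ^+ n) -> (forall n, `|g n| <= A * 8^-1 ^+ n) ->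
  series (fun n => \sum_(p < n.+1) f p * g (n - p)%N) @ \oo -->
  limn (series f) * limn (series g).
Proof.
move=> hf hg.
have A0 : 0 <= A by have := hf 0; rewrite expr0 mulr1; apply: le_trans.
have e8 n : 8^-1 ^+ n <= 2^-1 ^+ n :> R.
  by rewrite lerXn2r ?nnegrE ?invr_ge0// lef_pV2 ?posrE ?ler_nat.
have cvf : cvgn (series f).
  apply: (@cvg_series_geometric_bound f A) => n.
  by apply: le_trans (hf n) _; rewrite ler_wpM2l.
have cvg' : cvgn (series g).
  apply: (@cvg_series_geometric_bound g A) => n.
  by apply: le_trans (hg n) _; rewrite ler_wpM2l.
apply: cvg_sub0 (cvgM cvf cvg').
apply: (@squeeze_cvgr _ _ _ _ (- geometric (A ^+ 2) 2^-1)
                              (geometric (A ^+ 2) 2^-1)); last 2 first.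
- rewrite -oppr0; apply: cvgN; apply: cvg_geometric.
  by rewrite ger0_norm ?invr_ge0// invf_lt1 ?ltr1n.
- apply: cvg_geometric.
  by rewrite ger0_norm ?invr_ge0// invf_lt1 ?ltr1n.
apply: nearW => N; rewrite -ler_norml.
have -> : (series (fun n => \sum_(p < n.+1) f p * g (n - p)%N)
     - (series f * series g)) N =
   - \sum_(i < N) \sum_(N - i <= j < N) f i * g j.
  rewrite -[LHS]/(series _ N - series f N * series g N) series_conv.
  rewrite /series/= (big_mkord _ f) mulr_suml -sumrB -sumrN; apply: eq_bigr => i _.
  rewrite (big_cat_nat (n := (N - i)%N))//= ?leq_subr// mulrDr.
  by rewrite big_mkord opprD addrA subrr add0r mulr_sumr.
rewrite normrN.
apply: (@le_trans _ _ (\sum_(i < N) \sum_(0 <= j < N) A ^+ 2 * 8^-1 ^+ N)).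
  apply: (le_trans (ler_norm_sum _ _ _)); apply: ler_sum => i _.
  apply: (le_trans (ler_norm_sum _ _ _)).
  rewrite [leRHS](big_cat_nat (n := (N - i)%N))//= ?leq_subr//.
  apply: ler_wpDl.
    by apply: sumr_ge0 => j _; rewrite mulr_ge0 ?sqr_ge0// exprn_ge0 ?invr_ge0.
  apply: ler_sum_nat => j /andP[Nij _].
  rewrite normrM; apply: (@le_trans _ _ (A * 8^-1 ^+ i * (A * 8^-1 ^+ j))).
    by rewrite ler_pM.
  rewrite mulrACA -expr2 -exprD ler_wpM2l ?sqr_ge0//.
  apply: ler_wiXn2l; rewrite ?invr_ge0 ?invf_le1 ?ler1n//.
  by rewrite -leq_subLR.
rewrite sumr_const_nat subn0 sumr_const card_ord -mulrnA -[leLHS]mulr_natr -[leLHS]mulrA.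
rewrite /= ler_wpM2l ?sqr_ge0//.
have -> : 2^-1 ^+ N = 8^-1 ^+ N * (2 ^ N * 2 ^ N)%:R :> R.
  rewrite natrM !natrX -!exprMn; congr (_ ^+ _); lra.
rewrite ler_wpM2l ?exprn_ge0 ?invr_ge0// ler_nat.
by rewrite leq_mul// ltnW// ltn_expl.
Qed.

(** A homogeneous quadratic vector field, monomial by monomial: an entry (c, i, j) of [rhs k] stands
    for the term c y_i y_j of the k-th component. *)
Variable rhs : nat -> seq (R * nat * nat).

(** The recursion for Taylor coefficients needs all earlier orders, so each stage carries the whole
    table: stage m keeps the rows below m and fills all others with the coefficients of order m. The
    diagonal is the sequence sought. *)
Fixpoint taylor_table (y0 : nat -> R) (m : nat) : nat -> nat -> R :=
  if m is m'.+1 then fun p => if (p <= m')%N then taylor_table y0 m' p else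
    fun k => m%:R^-1 * \sum_(u <- rhs k) u.1.1 *
       \sum_(q < m) taylor_table y0 m' q u.1.2 * taylor_table y0 m' (m' - q)%N u.2
  else fun=> y0.

Lemma taylor_coefficients (y0 : nat -> R) : exists c : nat -> nat -> R,
  (forall k, c 0 k = y0 k) /\
  forall m k, m.+1%:R * c m.+1 k =
    \sum_(u <- rhs k) u.1.1 * \sum_(q < m.+1) c q u.1.2 * c (m - q)%N u.2.
Proof.
exists (fun m => taylor_table y0 m m); split => // m k.
have stable p n : (p <= n)%N -> taylor_table y0 n p = taylor_table y0 p p.
  elim: n => [|n IH]; first by rewrite leqn0 => /eqP ->.
  rewrite leq_eqVlt => /predU1P[->//|]; rewrite ltnS => pn.
  by rewrite /= pn IH.
rewrite [taylor_table y0 m.+1 m.+1]/= ltnn mulVKf ?pnatr_eq0//.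
apply: eq_bigr => u _; congr (_ * _); apply: eq_bigr => q _.
by rewrite (stable q) -1?ltnS// (stable (m - q)%N) ?leq_subr.
Qed.

(** Strong induction: each of the m+1 products in the convolution is at most M^2 (C M)^m, and their
    number cancels against the factor m+1 on the left of the recursion. *)
Lemma taylor_bound (C M : R) (c : nat -> nat -> R) : 0 <= M ->
  (forall k, \sum_(u <- rhs k) `|u.1.1| <= C) ->
  (forall k, `|c 0 k| <= M) ->
  (forall m k, m.+1%:R * c m.+1 k =
    \sum_(u <- rhs k) u.1.1 * \sum_(q < m.+1) c q u.1.2 * c (m - q)%N u.2) ->
  forall m k, `|c m k| <= M * (C * M) ^+ m.
Proof.
move=> M0 hC h0 hS m; elim/ltn_ind: m => -[_ k|m IH k].
  by rewrite expr0 mulr1.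
rewrite -(ler_pM2l (ltr0Sn R m)) -[in leLHS](ger0_norm (ler0n R m.+1)) -normrM.
have C0 : 0 <= C by apply: le_trans (hC 0); apply: sumr_ge0.
rewrite hS; apply: (@le_trans _ _ (\sum_(u <- rhs k) `|u.1.1| *
    (m.+1%:R * (M ^+ 2 * (C * M) ^+ m)))).
  apply: (le_trans (ler_norm_sum _ _ _)); apply: ler_sum => u _.
  rewrite normrM ler_wpM2l//; apply: (le_trans (ler_norm_sum _ _ _)).
  rewrite mulr_natl -[in leRHS](card_ord m.+1) -sumr_const.
  apply: ler_sum => q _; rewrite normrM.
  apply: (@le_trans _ _ (M * (C * M) ^+ q * (M * (C * M) ^+ (m - q)))).
    by rewrite ler_pM// IH// ltnS ?leq_subr// -ltnS.
  by rewrite mulrACA -expr2 -exprD subnKC// -ltnS.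
rewrite -mulr_suml; apply: le_trans (_ : C * (m.+1%:R * (M ^+ 2 * (C * M) ^+ m)) <= _).
  by rewrite ler_wpM2r// !mulr_ge0// ?sqr_ge0// exprn_ge0// mulr_ge0.
by rewrite [(C * M) ^+ m.+1]exprS le_eqVlt; apply/orP; left; apply/eqP; ring.
Qed.

Lemma cvg_series_lin (I : Type) (s : seq I) (c : I -> R) (F : I -> nat -> R)
    (l : I -> R) : (forall i, series (F i) @ \oo --> l i) ->
  series (fun n => \sum_(i <- s) c i * F i n) @ \oo --> \sum_(i <- s) c i * l i.
Proof.
move=> h.
have -> : series (fun n => \sum_(i <- s) c i * F i n) =
          fun n => \sum_(i <- s) c i * series (F i) n.
  apply/funext => n; rewrite /series/= exchange_big/=.
  by apply: eq_bigr => i _; rewrite mulr_sumr.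
elim: s => [|i s IH].
  rewrite big_nil; under eq_fun do rewrite big_nil.
  exact: cvg_cst.
rewrite big_cons; under eq_fun do rewrite big_cons.
by apply: cvgD => //; apply: cvgM; [exact: cvg_cst | exact: h].
Qed.

Lemma quadratic_ode (C M : R) : 0 < C -> 0 < M ->
  (forall k, \sum_(u <- rhs k) `|u.1.1| <= C) ->
  exists2 e : R, 0 < e & forall y0 : nat -> R, (forall k, `|y0 k| <= M) ->
  exists y : nat -> R -> R, (forall k, y k 0 = y0 k) /\
    forall t : R, `|t| < e -> forall k, is_derive t 1 (y k)
      (\sum_(u <- rhs k) u.1.1 * (y u.1.2 t * y u.2 t)).
Proof.
move=> C0 M0 hC; have CM0 : 0 < C * M by rewrite mulr_gt0.
(* For |t| <= K the terms decay like 8^-m. This leaves room for the factor 4^m lost in the Cauchy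
   product and for the factors 2^m and 4^m lost in differentiating once and twice. *)
pose K := (8 * (C * M))^-1.
have K0 : 0 < K by rewrite invr_gt0 mulr_gt0.
have CMK : C * M * K = 8^-1 by rewrite /K invfM mulrCA mulfV ?mulr1// gt_eqF.
exists K => // y0 hy0.
have [c [c0 cS]] := taylor_coefficients y0.
have cb m k : `|c m k| <= M * (C * M) ^+ m.
  apply: (taylor_bound (ltW M0) hC _ cS) => j; by rewrite c0.
have term m k t : `|t| <= K -> `|c m k * t ^+ m| <= M * 8^-1 ^+ m.
  move=> tK; rewrite normrM normrX -CMK exprMn mulrA.
  by apply: ler_pM => //; rewrite lerXn2r// nnegrE ltW.
pose y k t := limn (pseries (c^~ k) t).
exists y; split => [k|t tK k].
  rewrite /y -c0; apply: (@cvg_lim _ (@Rhausdorff R)).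
  (* The partial sum of index 0 is empty; the sums at 0 are constant only from index 1 on. *)
  rewrite -(cvg_shiftn 1)/=; apply: cvg_near_cst; apply: nearW => n.
  rewrite addn1 /pseries /series/= big_nat_recl//= expr0 mulr1.
  by rewrite big1 ?addr0// => i _; rewrite expr0n mulr0.
have two n : (n.+1%:R : R) <= 2 ^+ n by rewrite -natrX ler_nat ltn_expl.
(* By the recursion, the formally differentiated series is the same combination of Cauchy products,
   hence converges to the right-hand side of the equation. *)
have -> : \sum_(u <- rhs k) u.1.1 * (y u.1.2 t * y u.2 t) =
          limn (pseries (pseries_diffs (c^~ k)) t).
  apply/esym; apply: (@cvg_lim _ (@Rhausdorff R)).
  have -> : pseries (pseries_diffs (c^~ k)) t =
    series (fun m => \sum_(u <- rhs k) u.1.1 *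
       \sum_(q < m.+1) (c q u.1.2 * t ^+ q) * (c (m - q)%N u.2 * t ^+ (m - q))).
    rewrite /pseries; congr series; apply/funext => m.
    rewrite /pseries_diffs /= cS mulr_suml; apply: eq_bigr => u _.
    rewrite -mulrA mulr_suml; congr (_ * _); apply: eq_bigr => q _.
    by rewrite mulrACA -exprD subnKC// -ltnS.
  apply: (@cvg_series_lin _ _ (fun u => u.1.1) _ (fun u => y u.1.2 t * y u.2 t)).
  move=> u; apply: (@cvg_series_conv (fun q => c q u.1.2 * t ^+ q)
     (fun q => c q u.2 * t ^+ q) M) => n; exact/term/ltW.
have c8 n : M * 8^-1 ^+ n <= M * 2^-1 ^+ n.
  by rewrite ler_pM2l// lerXn2r ?nnegrE ?invr_ge0// lef_pV2 ?posrE ?ler_nat.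
(* Termwise differentiation inside radius K requires convergence at K of the series and of its first
   two formal derivatives. *)
apply: (@pseries_snd_diffs _ _ K).
- apply: (@cvg_series_geometric_bound _ M) => n.
  apply: le_trans (c8 n); apply: term; by rewrite ger0_norm// ltW.
- apply: (@cvg_series_geometric_bound _ (M * (C * M))) => n.
  rewrite /pseries_diffs !normrM (ger0_norm (ler0n _ _)).
  rewrite normrX (gtr0_norm K0).
  apply: (@le_trans _ _ (2 ^+ n * (M * (C * M) ^+ n.+1) * K ^+ n)).
    by rewrite ler_wpM2r ?exprn_ge0 ?(ltW K0)// ler_pM.
  have -> : 2 ^+ n * (M * (C * M) ^+ n.+1) * K ^+ n =
            M * (C * M) * (2 * (C * M * K)) ^+ n.
    by rewrite exprS !exprMn; ring.
  rewrite CMK ler_wpM2l ?mulr_ge0 ?(ltW M0) ?(ltW C0)// lerXn2r ?nnegrE//; lra.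
- apply: (@cvg_series_geometric_bound _ (2 * M * (C * M) ^+ 2)) => n.
  rewrite /pseries_diffs !normrM !(ger0_norm (ler0n _ _)).
  rewrite normrX (gtr0_norm K0).
  apply: (@le_trans _ _ (2 ^+ n * (2 ^+ n.+1 * (M * (C * M) ^+ n.+2)) * K ^+ n)).
    rewrite ler_wpM2r ?exprn_ge0 ?(ltW K0)// ler_pM ?mulr_ge0// ler_pM//.
  have -> : 2 ^+ n * (2 ^+ n.+1 * (M * (C * M) ^+ n.+2)) * K ^+ n =
            2 * M * (C * M) ^+ 2 * (4 * (C * M * K)) ^+ n.
    have -> : 4 = 2 * 2 :> R by lra.
    by rewrite !exprS !exprMn; ring.
  rewrite CMK ler_wpM2l ?(mulr_ge0 (mulr_ge0 (ler0n R 2) (ltW M0)) (sqr_ge0 _))// lerXn2r ?nnegrE//; lra.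
- by rewrite (gtr0_norm K0).
Qed.

End QuadraticODE.

(** * Uniqueness for quadratic systems *)

Section Uniqueness.
Context {R : realType}.

Lemma norm_le_1Dsqr (x : R) : `|x| <= 1 + x ^+ 2.
Proof.
have := sqr_ge0 (`|x| - 1); rewrite -(real_normK (num_real x)).
by have := normr_ge0 x; nra.
Qed.

(** Gronwall's inequality for S, the sum of the squared differences d_k = y_k - y'_k. By y_i y_j -
    y'_i y'_j = d_i y_j + y'_i d_j, the derivative of S is at most a continuous multiple of S. The
    first [n] components form a closed system, so finite sums suffice. *)
Lemma solves_unique (rhs : nat -> seq (R * nat * nat)) (n : nat) (C : R)
    (J : set R) (y y' : nat -> R -> R) (t0 t : R) : is_interval J ->
  (forall k, \sum_(u <- rhs k) `|u.1.1| <= C) ->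
  (forall k u, u \in rhs k -> (u.1.2 < n)%N && (u.2 < n)%N) ->
  (forall s : R, J s -> forall k, is_derive s 1 (y k)
    (\sum_(u <- rhs k) u.1.1 * (y u.1.2 s * y u.2 s))) ->
  (forall s : R, J s -> forall k, is_derive s 1 (y' k)
    (\sum_(u <- rhs k) u.1.1 * (y' u.1.2 s * y' u.2 s))) ->
  J t0 -> J t -> (forall k, (k < n)%N -> y k t0 = y' k t0) ->
  forall k, (k < n)%N -> y k t = y' k t.
Proof.
move=> iJ hC hn hy hy' Jt0 Jt e0.
pose d k s := y k s - y' k s.
pose S s := \sum_(k < n) d k s ^+ 2.
(* Squares make Y differentiable, hence continuous; thanks to the summand 1 it still dominates every
   |y_k| and |y'_k|. *)
pose Y s := \sum_(k < n) (1 + y k s ^+ 2 + y' k s ^+ 2).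
pose F (z : nat -> R -> R) k s := \sum_(u <- rhs k) u.1.1 * (z u.1.2 s * z u.2 s).
have dd s k : J s -> is_derive s 1 (d k) (F y k s - F y' k s).
  move=> Js; have h1 := hy _ Js k; have h2 := hy' _ Js k.
  exact: derD h1 (derN h2).
have dS s : J s -> is_derive s 1 S
    (\sum_(k < n) 2 * d k s * (F y k s - F y' k s)).
  move=> Js; apply: der_sum => k; have h := dd s k Js.
  by der; ring.
have cY s : J s -> {for s, continuous Y}.
  move=> Js; have : is_derive s 1 Y
    (\sum_(k < n) (2 * y k s * F y k s + 2 * y' k s * F y' k s)).
    apply: der_sum => k; have h1 := hy _ Js k; have h2 := hy' _ Js k.
    by der; rewrite /F; ring.
  exact: der_continuous.
have d_le k s : (k < n)%N -> d k s ^+ 2 <= S s.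
  move=> kn; rewrite /S (bigD1 (Ordinal kn))//= lerDl.
  by apply: sumr_ge0 => *; exact: sqr_ge0.
have y_le k s : (k < n)%N -> `|y k s| <= Y s /\ `|y' k s| <= Y s.
  move=> kn; rewrite /Y (bigD1 (Ordinal kn))//=.
  have : 0 <= \sum_(i < n | i != Ordinal kn) (1 + y i s ^+ 2 + y' i s ^+ 2).
    by apply: sumr_ge0 => i _; rewrite !addr_ge0// sqr_ge0.
  have := norm_le_1Dsqr (y k s); have := norm_le_1Dsqr (y' k s).
  have := sqr_ge0 (y k s); have := sqr_ge0 (y' k s); lra.
have dd_le i j s : (i < n)%N -> (j < n)%N -> `|d i s| * `|d j s| <= S s.
  move=> hi hj; have := d_le i s hi; have := d_le j s hj.
  rewrite -(real_normK (num_real (d i s))) -(real_normK (num_real (d j s))).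
  by have := sqr_ge0 (`|d i s| - `|d j s|); nra.
have S0 s : 0 <= S s by apply: sumr_ge0 => *; exact: sqr_ge0.
have Y0 s : 0 <= Y s.
  by apply: sumr_ge0 => i _; rewrite !addr_ge0// sqr_ge0.
have : S t = 0.
  apply: (@gronwall_eq0 R J iJ S _ (fun s => (4 * n%:R * C) * Y s) dS _ _ _ t0) => //.
  - by move=> s Js; apply: cvgM; [exact: cvg_cst | exact: cY].
  - move=> s Js; apply: (le_trans (ler_norm_sum _ _ _)).
    have -> : 4 * n%:R * C * Y s * S s = \sum_(k < n) 4 * C * Y s * S s.
      by rewrite sumr_const card_ord -mulr_natr; ring.
    apply: ler_sum => k _; rewrite /F -sumrB normrM.
    apply: (@le_trans _ _ (`|2 * d k s| * \sum_(u <- rhs k) `|u.1.1 *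
       (d u.1.2 s * y u.2 s + y' u.1.2 s * d u.2 s)|)).
      rewrite ler_wpM2l//.
      apply: le_trans (ler_norm_sum _ _ _); rewrite le_eqVlt; apply/orP; left.
      by apply/eqP; congr (`|_|); apply: eq_bigr => u _; rewrite /d; ring.
    apply: (@le_trans _ _ (\sum_(u <- rhs k) `|u.1.1| * (4 * Y s * S s))).
      rewrite mulr_sumr big_seq [leRHS]big_seq; apply: ler_sum => u uk.
      have /andP[hi hj] := hn _ _ uk.
      rewrite !normrM (ger0_norm (ler0n R 2)).
      have [h1 _] := y_le _ s hj; have [_ h2] := y_le _ s hi.
      have h3 := dd_le _ _ s (ltn_ord k) hi; have h4 := dd_le _ _ s (ltn_ord k) hj.
      have h5 : `|d u.1.2 s * y u.2 s + y' u.1.2 s * d u.2 s| <=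
          `|d u.1.2 s| * Y s + Y s * `|d u.2 s|.
        apply: (le_trans (ler_normD _ _)); rewrite !normrM.
        by rewrite lerD// ?ler_wpM2l// ler_wpM2r.
      rewrite mulrCA ler_wpM2l//.
      apply: (@le_trans _ _ (2 * `|d k s| * (`|d u.1.2 s| * Y s + Y s * `|d u.2 s|))).
        by rewrite ler_wpM2l// mulr_ge0.
      have := ler_wpM2l (Y0 s) h3; have := ler_wpM2l (Y0 s) h4; lra.
    rewrite -mulr_suml; have := ler_wpM2r (mulr_ge0 (Y0 s) (S0 s)) (hC k).
    by lra.
  - by rewrite /S big1// => k _; rewrite /d e0 ?subrr ?expr0n.
move=> St k kn; apply/eqP; rewrite -subr_eq0 -sqrf_eq0 eq_le sqr_ge0 andbT.
by rewrite -St; exact: d_le.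
Qed.

End Uniqueness.

(** * Geodesics of left-invariant metrics on SL(2,R) *)

Section Matrices.
Context {R : realType}.

Lemma ord2_ind (P : 'I_2 -> Prop) : P 0 -> P 1 -> forall i, P i.
Proof.
move=> P0 P1 [[|[|//]] h].
  by have -> : Ordinal h = 0 by exact: val_inj.
by have -> : Ordinal h = 1 by exact: val_inj.
Qed.

Lemma big_ord2 (V : nmodType) (F : 'I_2 -> V) : \sum_i F i = F 0 + F 1.
Proof.
rewrite !big_ord_recl big_ord0 addr0; congr (F _ + F _); exact: val_inj.
Qed.

Lemma mul_mx2E (m n : nat) (A : 'M[R]_(m, 2)) (B : 'M[R]_(2, n)) i j :
  (A *m B) i j = A i 0 * B 0 j + A i 1 * B 1 j.
Proof. by rewrite mxE big_ord2. Qed.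

Lemma tr_mx2E (A : 'M[R]_2) : \tr A = A 0 0 + A 1 1.
Proof. by rewrite /mxtrace big_ord2. Qed.

Lemma det_mx2E (A : 'M[R]_2) : \det A = A 0 0 * A 1 1 - A 0 1 * A 1 0.
Proof.
rewrite (expand_det_row _ 0) big_ord2 /cofactor !det_mx11 !mxE /=.
have e k : lift (0 : 'I_2) (k : 'I_1) = 1 by apply: val_inj; case: k => -[].
have e' k : lift (1 : 'I_2) (k : 'I_1) = 0 by apply: val_inj; case: k => -[].
by rewrite !e e' expr0 expr1 mul1r mulN1r mulrN.
Qed.

Definition mx2 (x y z w : R) : 'M[R]_2 :=
  \matrix_(i, j) if i == 0 then if j == 0 then x else y
                 else if j == 0 then z else w.

Lemma mx2E x y z w : [/\ mx2 x y z w 0 0 = x, mx2 x y z w 0 1 = y,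
  mx2 x y z w 1 0 = z & mx2 x y z w 1 1 = w].
Proof. by rewrite !mxE. Qed.

Lemma invmx2 (g : 'M[R]_2) : \det g = 1 ->
  invmx g = mx2 (g 1 1) (- g 0 1) (- g 1 0) (g 0 0).
Proof.
move=> g1; have gu : g \in unitmx by rewrite unitmxE g1 unitr1.
apply: (can_inj (mulKmx gu)); rewrite mulmxV//.
have [e1 e2 e3 e4] := mx2E (g 1 1) (- g 0 1) (- g 1 0) (g 0 0).
apply/matrixP; rewrite det_mx2E in g1.
by do 2![elim/ord2_ind]; rewrite mul_mx2E ?(e1, e2, e3, e4) !mxE/=; lra.
Qed.

Lemma mx_is_deriveP (m n : nat) (M : R -> 'M[R]_(m, n)) (t : R) (dM : 'M[R]_(m, n)) :
  derivable M t 1 /\ derive1 M t = dM <->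
  forall i j, is_derive t 1 (fun s => M s i j) (dM i j).
Proof.
split=> [[h <-] i j|h].
  rewrite derive1E derive_mx// mxE.
  by have /derivable_mxP/(_ i j) := h => ?; apply: DeriveDef.
have hM : derivable M t 1 by apply/derivable_mxP => i j; have [] := h i j.
split=> //; rewrite derive1E derive_mx//; apply/matrixP => i j.
by rewrite mxE; have [] := h i j.
Qed.

Lemma der_scalar_mx (m n : nat) (l : {scalar 'M[R]_(m, n)})
    (M : R -> 'M[R]_(m, n)) (t : R) (dM : 'M[R]_(m, n)) :
  (forall i j, is_derive t 1 (fun s => M s i j) (dM i j)) ->
  is_derive t 1 (fun s => l (M s)) (l dM).
Proof.
move=> h.
have lE (A : 'M[R]_(m, n)) : l A = \sum_i \sum_j A i j * l (delta_mx i j).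
  rewrite {1}[A]matrix_sum_delta linear_sum; apply: eq_bigr => i _.
  by rewrite linear_sum; apply: eq_bigr => j _; rewrite linearZ.
under eq_fun do rewrite lE.
rewrite lE; apply: der_sum => i; apply: der_sum => j.
by have hij := h i j; der; rewrite mulr0 add0r mulrC.
Qed.

(** Jacobi's formula: where det g = 1, this trace is the derivative of the determinant, which is
    constant near [t]. *)
Lemma tangent_traceless (g : R -> 'M[R]_2) (t : R) (dg : 'M[R]_2) :
  (\forall s \near t, \det (g s) = 1) ->
  (forall i j, is_derive t 1 (fun s => g s i j) (dg i j)) ->
  \tr (invmx (g t) *m dg) = 0.
Proof.
move=> g1 hg; rewrite invmx2; last exact: nbhs_singleton g1.
have hdet : is_derive t 1 (fun s => \det (g s)) 0.
  apply: near_eq_is_derive (der_cst 1 t).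
  by near=> s; apply/esym; near: s.
have := hdet; under eq_fun do rewrite det_mx2E; move=> hdet'.
have [? ? ? ?] := And4 (hg 0 0) (hg 0 1) (hg 1 0) (hg 1 1).
have := @derive_val _ _ _ _ _ _ _ hdet'.
have -> := @derive_val _ _ _ _ _ _ _
  (derD (derM (hg 0 0) (hg 1 1)) (derN (derM (hg 0 1) (hg 1 0)))).
rewrite tr_mx2E !mul_mx2E.
have [-> -> -> ->] := mx2E (g t 1 1) (- g t 0 1) (- g t 1 0) (g t 0 0); lra.
Unshelve. all: by end_near. Qed.

End Matrices.

(** * The Lie algebra sl(2,R) and the Euler-Arnold equation *)

Section LieBracket.
Context {R : realType}.
Implicit Types x y w : sl2 R.

Lemma sl2P (A : 'M[R]_2) : (A \in sl2_space) = (\tr A == 0).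
Proof. by rewrite memv_ker lfunE. Qed.

Lemma tr_sl2 x : \tr (vsval x) = 0.
Proof. by apply/eqP; rewrite -sl2P subvsP. Qed.

Lemma vsval_bracket x y :
  vsval (bracket x y) = vsval x *m vsval y - vsval y *m vsval x.
Proof.
by rewrite vsprojK// sl2P linearB/= mxtrace_mulC subrr.
Qed.

Lemma bracketDl x y w : bracket (x + y) w = bracket x w + bracket y w.
Proof.
apply: subvs_inj; rewrite linearD/= !vsval_bracket linearD/= mulmxDl mulmxDr.
by rewrite addrACA opprD.
Qed.

Lemma bracketZl (c : R) x y : bracket (c *: x) y = c *: bracket x y.
Proof.
apply: subvs_inj; rewrite linearZ/= !vsval_bracket linearZ/= scalerBr.
by rewrite scalemxAl scalemxAr.
Qed.

Lemma bracketC x y : bracket x y = - bracket y x.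
Proof. by apply: subvs_inj; rewrite linearN/= !vsval_bracket opprB. Qed.

Lemma bracketDr x y w : bracket w (x + y) = bracket w x + bracket w y.
Proof. by rewrite bracketC bracketDl opprD -!bracketC. Qed.

Lemma bracketZr (c : R) x y : bracket y (c *: x) = c *: bracket y x.
Proof. by rewrite bracketC bracketZl -scalerN -bracketC. Qed.

Lemma bracketxx x : bracket x x = 0.
Proof. by apply: subvs_inj; rewrite linear0 vsval_bracket subrr. Qed.

(** Invariance of the trace form under the adjoint action, from the cyclicity of the trace. *)
Lemma B_bracket w x y : B w (bracket x y) = B (bracket w x) y.
Proof.
rewrite /B !vsval_bracket mulmxBr mulmxBl !linearB/= !mulmxA; congr (_ * (_ - _)).
by rewrite mxtrace_mulC mulmxA.
Qed.

(* Euler-Arnold: the Koszul formula for a left-invariant metric. *)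
Lemma levi_civita_diag (q : {biscalar (sl2 R)}) (Phi : 'End(sl2 R))
    (D : {bilinear (sl2 R) -> (sl2 R) -> (sl2 R)}) :
  pseudo_euclidean q -> associated_isomorphism q Phi -> levi_civita q D ->
  forall x, Phi (D x x) = - bracket (Phi x) x.
Proof.
move=> [qC q0] [/eqP kPhi _ qB] [Dtor Dmet] x.
(* Metric compatibility gives q(D x x, y) = - q(x, D x y) and q(x, D y x) = 0; absence of torsion
   then replaces D x y by the bracket. *)
have qDxx y : q (D x x) y = - q x (bracket x y).
  have := Dmet x x y; have := Dmet y x x.
  rewrite (qC (D y x) x) -mulr2n => /eqP; rewrite mulrn_eq0/= => /eqP h.
  by rewrite -(Dtor x y) linearBr/= h subr0 => /eqP; rewrite addr_eq0 => /eqP.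
pose m := (Phi^-1)%VF (bracket (Phi x) x).
have PhiK := lker0_lfunVK kPhi.
suff -> : D x x = - m by rewrite linearN/= PhiK.
apply/eqP; rewrite -addr_eq0; apply/eqP/q0 => y.
by rewrite linearDl/= qDxx !qB PhiK B_bracket addNr.
Qed.

End LieBracket.

(** * Coordinates in the normal basis *)

Section Coordinates.
Context {R : realType}.

Lemma ord3_ind (P : 'I_3 -> Prop) :
  P (inord 0) -> P (inord 1) -> P (inord 2) -> forall i, P i.
Proof. by move=> P0 P1 P2 i; rewrite -(inord_val i); case: i => -[|[|[|]]]. Qed.

Lemma big_ord3 (V : nmodType) (F : 'I_3 -> V) :
  \sum_i F i = F (inord 0) + F (inord 1) + F (inord 2).
Proof.
rewrite !big_ord_recl big_ord0 addr0 addrA.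
congr (F _ + F _ + F _); apply: val_inj; by rewrite /= inordK.
Qed.

Lemma z123_vec3 (x y z : R) :
  [/\ z1 (vec3 x y z) = x, z2 (vec3 x y z) = y & z3 (vec3 x y z) = z].
Proof. by rewrite /z1 /z2 /z3 !mxE !inordK. Qed.

Lemma rV3P (u v : 'rV[R]_3) : z1 u = z1 v -> z2 u = z2 v -> z3 u = z3 v -> u = v.
Proof. by move=> e1 e2 e3; apply/rowP; elim/ord3_ind. Qed.

Variables v1 v2 v3 : sl2 R.
Hypothesis hv : basis_of {:sl2 R} [:: v1; v2; v3].

Definition from_coords (z : 'rV[R]_3) : sl2 R :=
  z1 z *: v1 + z2 z *: v2 + z3 z *: v3.

Lemma from_coordsE z :
  from_coords z = \sum_(i < 3) z ord0 i *: [tuple v1; v2; v3]`_i.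
Proof. by rewrite big_ord3 !inordK. Qed.

Lemma from_coordsK : cancel from_coords (coords v1 v2 v3).
Proof.
move=> z; apply/rowP => i; rewrite mxE from_coordsE.
exact: (@coord_sum_free _ _ _ [tuple v1; v2; v3] (z ord0) i (basis_free hv)).
Qed.

Lemma coordsK : cancel (coords v1 v2 v3) from_coords.
Proof.
move=> x; rewrite from_coordsE.
rewrite [RHS](@coord_basis _ _ _ _ [tuple v1; v2; v3] x hv (memvf _)).
by apply: eq_bigr => i _; rewrite mxE.
Qed.

End Coordinates.

(** * Geodesics as solutions of a quadratic system *)

Section Geodesics.
Context {R : realType}.
Variables (q : {biscalar (sl2 R)}) (Phi : 'End(sl2 R)).
Variables (v1 v2 v3 : sl2 R) (eta gamma0 zeta : R).
Variable D : {bilinear (sl2 R) -> (sl2 R) -> (sl2 R)}.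
Hypothesis hq : pseudo_euclidean q.
Hypothesis hPhi : associated_isomorphism q Phi.
Hypothesis hv : normal_basis Phi v1 v2 v3 eta gamma0 zeta.
Hypothesis hD : levi_civita q D.

Let a := gamma0 - eta.
Let b := zeta.
Let E := lax_field a b.
Let Z := from_coords v1 v2 v3.
(** The left-invariant velocity whose image under [Phi] has coordinates z. *)
Let X z := (Phi^-1)%VF (Z z).
Let crd := coords v1 v2 v3.

Let basis_v : basis_of {:sl2 R} [:: v1; v2; v3]. Proof. by case: hv. Qed.
Let PhiK : cancel Phi (Phi^-1)%VF.
Proof. by apply: lker0_lfunK; case: hPhi => ->. Qed.
Let PhiVK : cancel (Phi^-1)%VF Phi.
Proof. by apply: lker0_lfunVK; case: hPhi => ->. Qed.

Lemma bracket_lax z : bracket (Z z) (X z) = Z (E z).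
Proof.
have [_ [_ [_ [[b12 b13 b23] [[p1 p2 p3] _]]]]] := hv.
rewrite /X /Z /from_coords !linearD/= !linearZ/= p1 p2 p3.
have b21 : bracket v2 v1 = - v3 by rewrite bracketC b12.
have b31 : bracket v3 v1 = - v2 by rewrite bracketC b13.
have b32 : bracket v3 v2 = v1 by rewrite bracketC b23 opprK.
rewrite -!scaleNr !(bracketDl, bracketDr, bracketZl, bracketZr, scalerDr).
rewrite !bracketxx b12 b13 b23 b21 b31 b32.
(* Comparing a single matrix entry, through the linear form [f] below, turns the vector identity
   into one that [ring] decides. *)
apply: subvs_inj; apply/matrixP => i j.
have [-> -> ->] := z123_vec3 (b * (z2 z ^+ 2 + z3 z ^+ 2))
  (z1 z * (a * z3 z - b * z2 z)) (z1 z * (a * z2 z + b * z3 z)).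
pose f (u : sl2 R) := vsval u i j.
have fD u v : f (u + v) = f u + f v by rewrite /f linearD mxE.
have fZ c u : f (c *: u) = c * f u by rewrite /f linearZ mxE.
have fN u : f (- u) = - f u by rewrite /f linearN mxE.
have f0 : f 0 = 0 by rewrite /f linear0 mxE.
rewrite -!/(f _) !(fD, fZ, fN, f0) /a /b; ring.
Qed.

Lemma D_diag z : D (X z) (X z) = - X (E z).
Proof.
apply: (can_inj PhiK); rewrite (levi_civita_diag hq hPhi hD).
by rewrite linearN/= !PhiVK bracket_lax.
Qed.

Lemma velocity_mxE u i j : vsval (X u) i j = z1 u * vsval ((Phi^-1)%VF v1) i j +
  z2 u * vsval ((Phi^-1)%VF v2) i j + z3 u * vsval ((Phi^-1)%VF v3) i j.
Proof. by rewrite /X /Z /from_coords !(linearD, linearZ)/= !mxE. Qed.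

(** The determinant of [g] is left free: it is constant along solutions by [flow_det], so it need
    only be known at one time. *)
Definition flow (g : R -> 'M[R]_2) (z : R -> 'rV[R]_3) (t : R) : Prop :=
  (forall i j, is_derive t 1 (fun s => g s i j) ((g t *m vsval (X (z t))) i j)) /\
  (forall i, is_derive t 1 (fun s => z s ord0 i) (E (z t) ord0 i)).

Lemma near_flow g z g' z' t : (\forall s \near t, g s = g' s /\ z s = z' s) ->
  flow g z t -> flow g' z' t.
Proof.
move=> h [f1 f2]; have [e1 e2] := nbhs_singleton h.
split=> [i j|i].
  rewrite -e1 -e2; apply: near_eq_is_derive (f1 i j).
  by near=> s; have [->] : g s = g' s /\ z s = z' s by near: s.
rewrite -e2; apply: near_eq_is_derive (f2 i).
by near=> s; have [_ ->] : g s = g' s /\ z s = z' s by near: s.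
Unshelve. all: by end_near. Qed.

Lemma flow_mul (A : 'M[R]_2) g z t :
  flow g z t -> flow (fun s => A *m g s) z t.
Proof.
move=> [f1 f2]; split => // i j.
under eq_fun do rewrite mul_mx2E.
have h0 := f1 0 j; have h1 := f1 1 j.
by rewrite -mulmxA mul_mx2E; der; ring.
Qed.

Lemma flow_shift g z (t0 t : R) : flow g z (t - t0) ->
  flow (fun s => g (s - t0)) (fun s => z (s - t0)) t.
Proof.
have h : is_derive t 1 (fun s => s - t0) 1 by der; ring.
move=> [f1 f2]; split=> [i j|i]; rewrite -[X in is_derive _ _ _ X]mul1r.
  exact: (der_comp h (f1 i j)).
exact: (der_comp h (f2 i)).
Qed.

(** Liouville's formula: the derivative of det g is det g times the trace of [X (z t)], and elements
    of sl(2,R) are traceless. *)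
Lemma flow_det (J : set R) g z : is_interval J ->
  (forall t, J t -> flow g z t) -> forall s t, J s -> J t ->
  \det (g s) = \det (g t).
Proof.
move=> iJ h s t Js Jt; apply: (interval_const (f := fun s => \det (g s)) iJ _ Js Jt) => x Jx.
under eq_fun do rewrite det_mx2E.
have [f1 _] := h x Jx.
have [? ? ? ?] := And4 (f1 0 0) (f1 0 1) (f1 1 0) (f1 1 1).
have := tr_sl2 (X (z x)); rewrite tr_mx2E => tr0.
der; rewrite !mul_mx2E.
have -> : vsval (X (z x)) 1 1 = - vsval (X (z x)) 0 0 by lra.
ring.
Qed.

Lemma geodesic_flow (I : set R) gamma : geodesic D I gamma ->
  forall t, I t -> flow gamma (fun s => crd (Phi (velocity gamma s))) t.
Proof.
move=> [[_ oI _] hg] t It; have [g1 dg dx ex] := hg t It.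
set x := velocity gamma t; set w := crd (Phi x).
have XwE : X w = x by rewrite /X /Z /w coordsK.
split.
- apply/mx_is_deriveP; split => //; rewrite XwE /x /velocity vsprojK.
    by rewrite mulKVmx// unitmxE g1 unitr1.
  rewrite sl2P; apply/eqP/tangent_traceless.
    near=> s; suff /hg[] : I s by [].
    by near: s; exact: open_nbhs_nbhs.
  by apply/mx_is_deriveP; split.
- move=> i.
  (* The i-th coordinate of [Phi], extended by [vsproj] to all matrices so that it can be applied to
     the derivative of a matrix-valued curve. *)
  pose l : {scalar 'M[R]_2} :=
    (coord [tuple v1; v2; v3] i \o Phi \o vsproj sl2_space).
  have hx := (mx_is_deriveP (fun s => vsval (velocity gamma s)) t _).1
    (conj dx erefl).
  have lE y : l (vsval y) = crd (Phi y) ord0 i.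
    by rewrite /l/= vsvalK mxE.
  have := der_scalar_mx l hx.
  under eq_fun do rewrite lE.
  move/der_eq; apply; move/eqP: ex; rewrite addr_eq0 => /eqP ->.
  rewrite linearN lE -/x -XwE D_diag linearN/= /X !PhiVK.
  rewrite [crd (Z w)](from_coordsK basis_v).
  by rewrite -[E w in RHS](from_coordsK basis_v) !mxE linearN opprK.
Unshelve. all: by end_near. Qed.

(** The equation for [g] identifies the velocity with X(z). Its derivative is X(E(z)), which
    [D_diag] shows to be cancelled by the connection term. *)
Lemma flow_geodesic (J : set R) g z : open_interval J ->
  (forall t, J t -> \det (g t) = 1) -> (forall t, J t -> flow g z t) ->
  geodesic D J g.
Proof.
move=> oJ g1 hf; split=> // t Jt x.
have vel s : J s -> velocity g s = X (z s).
  move=> Js; have [/mx_is_deriveP[_ e] _] := hf s Js.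
  by rewrite /velocity e mulKmx ?vsvalK// unitmxE g1 ?unitr1.
have [/mx_is_deriveP[dg _] f2] := hf t Jt.
have nJ : \forall s \near t, J s by case: oJ => _ oJ _; exact: open_nbhs_nbhs.
have [dx ex] : derivable (fun s => vsval (x s)) t 1 /\
    derive1 (fun s => vsval (x s)) t = vsval (X (E (z t))).
  apply/mx_is_deriveP => i j.
  apply: (@near_eq_is_derive _ _ _ (fun s => vsval (X (z s)) i j)).
    by near=> s; rewrite /x vel//; near: s.
  under eq_fun do rewrite velocity_mxE.
  have := f2 (inord 0); have := f2 (inord 1); have := f2 (inord 2).
  rewrite -!/(z1 _) -!/(z2 _) -!/(z3 _) => h3 h2 h1; rewrite velocity_mxE.
  by rewrite /z1 /z2 /z3 in h1 h2 h3 *; der; ring.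
split=> //; first exact: g1.
by rewrite ex /x vel// D_diag linearN/= subrr.
Unshelve. all: by end_near. Qed.

(** Indices 0 to 3 are the entries of [g] row by row, 4 to 6 the coordinates of [z]; beyond them the
    default 0 makes an infinite family, as [quadratic_ode] requires. *)
Definition flow_state (g : 'M[R]_2) (z : 'rV[R]_3) (k : nat) : R :=
  nth 0 [:: g 0 0; g 0 1; g 1 0; g 1 1; z1 z; z2 z; z3 z] k.

(** Monomials of an entry of g X(z) in column [j]; [k] and [l] are the indices in [flow_state] of
    the two entries of the row of g concerned. *)
Let row_terms (j : 'I_2) (k l : nat) : seq (R * nat * nat) :=
  [:: (vsval ((Phi^-1)%VF v1) 0 j, k, 4); (vsval ((Phi^-1)%VF v2) 0 j, k, 5);
      (vsval ((Phi^-1)%VF v3) 0 j, k, 6); (vsval ((Phi^-1)%VF v1) 1 j, l, 4);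
      (vsval ((Phi^-1)%VF v2) 1 j, l, 5); (vsval ((Phi^-1)%VF v3) 1 j, l, 6)].

Definition flow_rhs (k : nat) : seq (R * nat * nat) :=
  nth [::] [:: row_terms 0 0 1; row_terms 1 0 1; row_terms 0 2 3; row_terms 1 2 3;
    [:: (b, 5, 5); (b, 6, 6)]; [:: (a, 4, 6); (- b, 4, 5)];
    [:: (a, 4, 5); (b, 4, 6)]] k.

Lemma flow_rhs_lt k u : u \in flow_rhs k -> (u.1.2 < 7)%N && (u.2 < 7)%N.
Proof.
move: k => [|[|[|[|[|[|[|k]]]]]]]; last by rewrite /flow_rhs nth_default.
all: rewrite /flow_rhs/= !inE => /orP h; repeat
  (case: h => [/eqP ->//|h]; try move/orP: h => h); by move/eqP: h => ->.
Qed.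

Lemma flow_rhs_bound : exists2 C, 0 < C &
  forall k, \sum_(u <- flow_rhs k) `|u.1.1| <= C.
Proof.
pose c k := \sum_(u <- flow_rhs k) `|u.1.1|.
have c0 k : 0 <= c k by exact: sumr_ge0.
exists (1 + \sum_(k < 7) c k); first by rewrite ltr_pwDl// sumr_ge0.
move=> k; case: (ltnP k 7) => hk; last first.
  by rewrite /flow_rhs nth_default// big_nil addr_ge0// sumr_ge0.
rewrite (bigD1 (Ordinal hk))//= -/(c k).
by rewrite ler_wpDl// lerDl sumr_ge0.
Qed.

Lemma flow_stateP g z t : flow g z t <->
  forall k, (k < 7)%N -> is_derive t 1 (fun s => flow_state (g s) (z s) k)
    (\sum_(u <- flow_rhs k) u.1.1 *
      (flow_state (g t) (z t) u.1.2 * flow_state (g t) (z t) u.2)).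
Proof.
have [e1 e2 e3] := z123_vec3 (b * (z2 (z t) ^+ 2 + z3 (z t) ^+ 2))
  (z1 (z t) * (a * z3 (z t) - b * z2 (z t)))
  (z1 (z t) * (a * z2 (z t) + b * z3 (z t))).
split=> [[f1 f2]|h].
- move: (f2 (inord 0)) (f2 (inord 1)) (f2 (inord 2)).
  rewrite -/(z1 (E (z t))) -/(z2 (E (z t))) -/(z3 (E (z t))) e1 e2 e3.
  move=> h1 h2 h3.
  case=> [|[|[|[|[|[|[|//]]]]]]] _; rewrite /flow_rhs/= !big_cons big_nil/=.
  + by apply: der_eq (f1 0 0) _; rewrite mul_mx2E !velocity_mxE /flow_state/=; ring.
  + by apply: der_eq (f1 0 1) _; rewrite mul_mx2E !velocity_mxE /flow_state/=; ring.
  + by apply: der_eq (f1 1 0) _; rewrite mul_mx2E !velocity_mxE /flow_state/=; ring.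
  + by apply: der_eq (f1 1 1) _; rewrite mul_mx2E !velocity_mxE /flow_state/=; ring.
  + by apply: der_eq h1 _; rewrite /flow_state/=; ring.
  + by apply: der_eq h2 _; rewrite /flow_state/=; ring.
  + by apply: der_eq h3 _; rewrite /flow_state/=; ring.
- split.
    do 2![elim/ord2_ind]; rewrite mul_mx2E !velocity_mxE.
    + by apply: der_eq (h 0 isT) _; rewrite /flow_rhs/= !big_cons big_nil /flow_state/=; ring.
    + by apply: der_eq (h 1 isT) _; rewrite /flow_rhs/= !big_cons big_nil /flow_state/=; ring.
    + by apply: der_eq (h 2 isT) _; rewrite /flow_rhs/= !big_cons big_nil /flow_state/=; ring.
    + by apply: der_eq (h 3 isT) _; rewrite /flow_rhs/= !big_cons big_nil /flow_state/=; ring.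
  elim/ord3_ind.
  + rewrite -/(z1 (E (z t))) e1; apply: der_eq (h 4 isT) _.
    by rewrite /flow_rhs/= !big_cons big_nil/= /flow_state/=; ring.
  + rewrite -/(z2 (E (z t))) e2; apply: der_eq (h 5 isT) _.
    by rewrite /flow_rhs/= !big_cons big_nil/= /flow_state/=; ring.
  + rewrite -/(z3 (E (z t))) e3; apply: der_eq (h 6 isT) _.
    by rewrite /flow_rhs/= !big_cons big_nil/= /flow_state/=; ring.
Qed.

Lemma flow_exists (M : R) : exists2 e : R, 0 < e &
  forall z0 : 'rV[R]_3, (forall i, `|z0 ord0 i| <= M) ->
  exists (g : R -> 'M[R]_2) (z : R -> 'rV[R]_3),
  [/\ g 0 = 1%:M, z 0 = z0 & forall t : R, `|t| < e -> flow g z t].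
Proof.
have [C C0 hC] := flow_rhs_bound.
(* This number bounds both [z0] and the entries of the unit matrix, whatever the sign of [M]. *)
have M0 : 0 < 1 + `|M| by rewrite ltr_pwDl.
have [e e0 he] := quadratic_ode C0 M0 hC; exists e => // z0 hz0.
have [k|y [y0 hy]] := he (flow_state 1%:M z0).
  have hz i : `|z0 ord0 i| <= 1 + `|M|.
    by rewrite (le_trans (hz0 i))// (le_trans (ler_norm _))// lerDr.
  have h1 : (1 : R) <= 1 + `|M| by rewrite lerDl.
  move: k => [|[|[|[|[|[|[|k]]]]]]]; rewrite /flow_state/= ?hz ?mxE//=
    ?normr1 ?normr0 ?nth_nil ?normr0 ?(ltW M0)//.
pose g t := mx2 (y 0%N t) (y 1%N t) (y 2 t) (y 3 t).
pose z t := vec3 (y 4 t) (y 5 t) (y 6 t).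
have gzE t k : (k < 7)%N -> flow_state (g t) (z t) k = y k t.
  have [g0 g1 g2 g3] := mx2E (y 0%N t) (y 1%N t) (y 2 t) (y 3 t).
  have [? ? ?] := z123_vec3 (y 4 t) (y 5 t) (y 6 t).
  by case: k => [|[|[|[|[|[|[|//]]]]]]] _; rewrite /flow_state/=.
have init k : (k < 7)%N -> flow_state (g 0) (z 0) k = flow_state 1%:M z0 k.
  by move=> k7; rewrite gzE.
exists g, z; split.
- apply/matrixP; do 2![elim/ord2_ind].
  + exact: (init 0%N isT).
  + exact: (init 1%N isT).
  + exact: (init 2 isT).
  + exact: (init 3 isT).
- by apply: rV3P; [exact: (init 4 isT)|exact: (init 5 isT)|exact: (init 6 isT)].
- move=> t te; apply/flow_stateP => k k7.
  have -> : (fun s => flow_state (g s) (z s) k) = y k.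
    by apply/funext => s; rewrite gzE.
  apply: der_eq (hy t te k) _; apply: eq_big_seq => u uk.
  by have /andP[? ?] := flow_rhs_lt uk; rewrite !gzE.
Qed.

Lemma flow_unique (J : set R) g z g' z' t0 t : is_interval J ->
  (forall s, J s -> flow g z s) -> (forall s, J s -> flow g' z' s) ->
  J t0 -> J t -> g t0 = g' t0 -> z t0 = z' t0 -> g t = g' t /\ z t = z' t.
Proof.
move=> iJ h h' Jt0 Jt eg ez.
have [C _ hC] := flow_rhs_bound.
(* From index 7 on, the state and the right-hand side are both 0 by default, so the equations hold
   for every index. *)
have full (g1 : R -> 'M[R]_2) z1 s : flow g1 z1 s ->
    forall k, is_derive s 1 (fun s => flow_state (g1 s) (z1 s) k)
    (\sum_(u <- flow_rhs k) u.1.1 *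
      (flow_state (g1 s) (z1 s) u.1.2 * flow_state (g1 s) (z1 s) u.2)).
  move/flow_stateP => f k; case: (ltnP k 7) => [/f//|k7].
  rewrite /flow_rhs nth_default// big_nil.
  under eq_fun do rewrite /flow_state nth_default//.
  exact: der_cst.
have st := solves_unique iJ hC flow_rhs_lt (fun s Js => full _ _ s (h s Js))
  (fun s Js => full _ _ s (h' s Js)) Jt0 Jt.
have {}st k : (k < 7)%N -> flow_state (g t) (z t) k = flow_state (g' t) (z' t) k.
  by apply: st => j _ /=; rewrite eg ez.
split; last by apply: rV3P; [exact: (st 4)|exact: (st 5)|exact: (st 6)].
apply/matrixP; do 2![elim/ord2_ind].
- exact: (st 0%N).
- exact: (st 1%N).
- exact: (st 2).
- exact: (st 3).
Qed.

(** Uniqueness on the interval where both are defined makes the solutions agree there, so a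
    definition by cases solves the system near every point. The union is an interval because it is a
    union of two connected sets sharing [t0]. *)
Lemma flow_glue (I V : set R) g z g' z' t0 :
  open_interval I -> open_interval V -> I t0 -> V t0 ->
  (forall t, I t -> flow g z t) -> (forall t, V t -> flow g' z' t) ->
  g t0 = g' t0 -> z t0 = z' t0 ->
  exists d zd, open_interval (I `|` V) /\
    (forall t, I t -> g t = d t) /\ forall t, (I `|` V) t -> flow d zd t.
Proof.
move=> [_ oI iI] [_ oV iV] It0 Vt0 fI fV eg ez.
have agree s : I s -> V s -> g s = g' s /\ z s = z' s.
  move=> Is Vs; apply: (@flow_unique (I `&` V) _ _ _ _ t0) => //.
  - by move=> x y [? ?] [? ?] u h; split; [exact: (iI x y) | exact: (iV x y)].
  - by move=> u [/fI].
  - by move=> u [_ /fV].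
pose d s := if `[< V s >] then g' s else g s.
pose zd s := if `[< V s >] then z' s else z s.
have dV s : V s -> d s = g' s /\ zd s = z' s by move=> h; rewrite /d /zd asboolT.
have dI s : I s -> d s = g s /\ zd s = z s.
  move=> Is; have [Vs|nVs] := pselect (V s).
    by have [-> ->] := dV _ Vs; have [-> ->] := agree s Is Vs.
  by rewrite /d /zd asboolF.
exists d, zd; split; [split|split].
- by exists t0; left.
- exact: openU.
- apply/connected_intervalP/connectedU; first by exists t0.
    exact/connected_intervalP.
  exact/connected_intervalP.
- by move=> t /dI[].
- move=> t [It|Vt].
  + apply: near_flow (fI t It); near=> x.
    suff /dI[-> ->] : I x by [].
    by near: x; exact: open_nbhs_nbhs.
  + apply: near_flow (fV t Vt); near=> x.
    suff /dV[-> ->] : V x by [].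
    by near: x; exact: open_nbhs_nbhs.
Unshelve. all: by end_near. Qed.

(** A local solution starting at the unit matrix is moved to [gamma t0] by a left translation and a
    time shift, then glued to [gamma]. Maximality forces the enlarged interval to be [I]. *)
Lemma maximal_geodesic_extends (I : set R) gamma (M : R) :
  maximal (geodesic D) I gamma -> exists2 e : R, 0 < e & forall t0, I t0 ->
  (forall i, `|crd (Phi (velocity gamma t0)) ord0 i| <= M) ->
  forall s, `|s - t0| < e -> I s.
Proof.
move=> [hg maxg]; have hw := geodesic_flow hg; have [oI gI] := hg.
have [e e0 he] := flow_exists M; exists e => // t0 It0 wt0.
have [g [z [g0 z0 gz]]] := he _ wt0.
pose V := [set` `]t0 - e, t0 + e[].
have VE s : V s <-> `|s - t0| < e by rewrite ltr_distl /V/= in_itv.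
have Vt0 : V t0 by apply/VE; rewrite subrr normr0.
have oV : open_interval V.
  split; [by exists t0 | exact: interval_open | exact: interval_is_interval].
have fV s : V s -> flow (fun s => gamma t0 *m g (s - t0)) (fun s => z (s - t0)) s.
  by move/VE => Vs; apply: flow_mul; apply: flow_shift; exact: gz.
have [||d [zd [oJ [dI fJ]]]] := flow_glue oI oV It0 Vt0 hw fV.
- by rewrite subrr g0 mulmx1.
- by rewrite subrr z0.
have det1 s : (I `|` V) s -> \det (d s) = 1.
  move=> Js; have iJ : is_interval (I `|` V) by case: oJ.
  rewrite (flow_det iJ fJ Js (or_introl It0)) -dI//.
  by have [] := gI t0 It0.
have <- := maxg _ d (flow_geodesic oJ det1 fJ) (fun s Is => or_introl Is) dI.
by move=> s h; right; apply/VE.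
Qed.

End Geodesics.

(** * Dynamics of the Lax vector field *)

Section Unbounded.
Context {R : realType}.
Variable I : set R.
Hypothesis iI : is_interval I.

Lemma steps_unbounded_above (e t0 : R) : 0 < e -> I t0 ->
  (forall t, I t -> t0 <= t -> forall s, `|s - t| < e -> I s) -> ~ has_ubound I.
Proof.
move=> e0 It0 h [u hu].
have In n : I (t0 + n%:R * (e / 2)).
  elim: n => [|n IH]; first by rewrite mul0r addr0.
  apply: (h _ IH); first by rewrite lerDl mulr_ge0// divr_ge0// ltW.
  rewrite -natr1 (_ : _ - _ = e / 2); last by ring.
  by rewrite gtr0_norm; lra.
have e2 : 0 < e / 2 by lra.
have := archi_boundP (normr_ge0 ((u - t0) / (e / 2))).
set n := Num.bound _; move=> hn.
have := hu _ (In n); rewrite leNgt => /negP; apply.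
rewrite -ltrBlDl -ltr_pdivrMr//; apply: le_lt_trans hn.
exact: ler_norm.
Qed.

(** From f' >= m one gets 1 + K <= (1 + K) f' / m, hence 1 + f^2 <= ((1 + K) / m + c) f': a Riccati
    inequality, which bounds the remaining time by pi / e. *)
Lemma has_ubound_blowup (f df : R -> R) (m K c t0 : R) :
  (forall t, I t -> is_derive t 1 f (df t)) -> I t0 ->
  0 < m -> 0 <= K -> 0 < c ->
  (forall t, I t -> t0 <= t -> m <= df t /\ f t ^+ 2 <= K + c * df t) ->
  has_ubound I.
Proof.
move=> hf It0 m0 K0 c0 h; pose e := ((1 + K) / m + c)^-1.
have e0 : 0 < e by rewrite invr_gt0 addr_gt0// divr_gt0// ltr_pwDl.
exists (t0 + pi / e) => t It; case: (leP t t0) => tt0.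
  by rewrite (le_trans tt0)// lerDl divr_ge0 ?pi_ge0 ?ltW.
rewrite -lerBlDl ler_pdivlMr// mulrC.
apply: (riccati_blowup iI hf It0 It (ltW tt0)) => x /andP[h1 h2].
have Ix : I x by apply: (iI It0 It); rewrite h1.
have [h3 h4] := h _ Ix h1; rewrite /e ler_pdivrMl; last by rewrite -invr_gt0.
have : 1 + K <= (1 + K) / m * df x.
  by rewrite -mulrA ler_peMr ?addr_ge0// ler_pdivlMl// mulr1.
by rewrite mulrDl; lra.
Qed.

End Unbounded.

(** * Time reversal *)

Section Reflection.
Context {R : realType}.
Implicit Type I : set R.

Definition opp_set I := [set t | I (- t)].

Lemma is_interval_opp I : is_interval I -> is_interval (opp_set I).
Proof.
move=> iI x y Ix Iy z /andP[h1 h2]; apply: (iI _ _ Iy Ix).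
by rewrite !lerN2 h1 h2.
Qed.

Lemma has_ubound_opp I : has_ubound (opp_set I) <-> has_lbound I.
Proof.
split=> -[u hu]; exists (- u) => t It.
  by rewrite lerNl; apply: hu; rewrite /opp_set/= opprK.
by rewrite lerNr; exact: hu.
Qed.

Lemma has_lbound_opp I : has_lbound (opp_set I) <-> has_ubound I.
Proof.
split=> -[u hu]; exists (- u) => t It.
  by rewrite lerNr; apply: hu; rewrite /opp_set/= opprK.
by rewrite lerNl; exact: hu.
Qed.

Lemma der_opp (f : R -> R) (d t : R) :
  is_derive (- t) 1 f d -> is_derive t 1 (fun s => f (- s)) (- d).
Proof.
move=> hf; have hN : is_derive t 1 (fun s => - s) (- 1) by exact: derN (der_id t).
by rewrite -mulN1r; exact: der_comp hN hf.
Qed.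

Lemma steps_unbounded_below I (e t0 : R) : 0 < e -> I t0 ->
  (forall t, I t -> t <= t0 -> forall s, `|s - t| < e -> I s) -> ~ has_lbound I.
Proof.
move=> e0 It0 h /has_ubound_opp; apply: (@steps_unbounded_above _ _ e (- t0)) => //.
  by rewrite /opp_set/= opprK.
move=> t It tt0 s st; apply: (h (- t)) => //; first by rewrite lerNl.
by rewrite -opprD normrN.
Qed.

Lemma has_lbound_blowup I (f df : R -> R) (m K c t0 : R) : is_interval I ->
  (forall t, I t -> is_derive t 1 f (df t)) -> I t0 ->
  0 < m -> 0 <= K -> 0 < c ->
  (forall t, I t -> t <= t0 -> m <= df t /\ f t ^+ 2 <= K + c * df t) ->
  has_lbound I.
Proof.
move=> iI hf It0 m0 K0 c0 h; apply/has_ubound_opp.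
apply: (@has_ubound_blowup _ _ (is_interval_opp iI) (fun t => - f (- t))
  (fun t => df (- t)) m K c (- t0)) => //.
- by move=> t It; rewrite -[df _]opprK; apply/derN/der_opp/hf.
- by rewrite /opp_set/= opprK.
- by move=> t It tt0; rewrite sqrrN; apply: h; rewrite // lerNl.
Qed.

Lemma unbounded_interval_setT I : is_interval I -> I !=set0 ->
  ~ has_ubound I -> ~ has_lbound I -> I = setT.
Proof.
move=> iI I0 nu nl; apply/seteqP; split=> // x _.
have [[y Iy xy]|h] := pselect (exists2 y, I y & x <= y); last first.
  exfalso; apply: nu; exists x => y Iy; rewrite leNgt; apply/negP => xy.
  by apply: h; exists y => //; exact: ltW.
have [[z Iz zx]|h] := pselect (exists2 z, I z & z <= x); last first.
  exfalso; apply: nl; exists x => z Iz; rewrite leNgt; apply/negP => zx.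
  by apply: h; exists z => //; exact: ltW.
by apply: (iI _ _ Iz Iy); rewrite zx.
Qed.

Lemma has_ubound_proper I : has_ubound I -> I <> setT.
Proof.
move=> [u hu] IT; have := hu (u + 1); rewrite IT => /(_ Logic.I); lra.
Qed.

(** Gronwall's inequality applied to f^2, whose derivative is 2 g f^2. *)
Lemma linear_ode_eq0 I (f g : R -> R) : is_interval I ->
  (forall t, I t -> is_derive t 1 f (g t * f t)) ->
  (forall t, I t -> {for t, continuous g}) ->
  forall s t, I s -> I t -> f s = 0 -> f t = 0.
Proof.
move=> iI hf cg s t Is It fs; apply/eqP; rewrite -sqrf_eq0; apply/eqP.
apply: (@gronwall_eq0 R I iI (fun x => f x ^+ 2) (fun x => 2 * g x * f x ^+ 2)
  (fun x => 2 * `|g x|) _ _ _ _ s) => //.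
- by move=> x Ix; have h := hf x Ix; der; ring.
- by move=> x Ix; apply: cvgM; [exact: cvg_cst | exact: cvg_norm (cg x Ix)].
- by move=> x _; exact: sqr_ge0.
- move=> x _; rewrite !normrM (ger0_norm (ler0n R 2)).
  by rewrite -expr2 real_normK ?num_real.
- by rewrite fs expr0n.
Qed.

End Reflection.

(** * The planar system x' = r p w^2, w' = r x w *)

Section PlaneFlow.
Context {R : realType}.
Variables (r p : R) (I : set R) (x w : R -> R).
Hypotheses (r0 : 0 < r) (p0 : 0 < p) (iI : is_interval I).
Hypothesis hx : forall t, I t -> is_derive t 1 x (r * p * w t ^+ 2).
Hypothesis hw : forall t, I t -> is_derive t 1 w (r * x t * w t).
Hypothesis w0 : forall t, I t -> w t != 0.
Hypothesis ext : forall M : R, exists2 e : R, 0 < e & forall t0, I t0 ->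
  `|x t0| <= M -> `|w t0| <= M -> forall s, `|s - t0| < e -> I s.

Lemma plane_flow_energy s t : I s -> I t ->
  x s ^+ 2 - p * w s ^+ 2 = x t ^+ 2 - p * w t ^+ 2.
Proof.
apply: (interval_const (f := fun t => x t ^+ 2 - p * w t ^+ 2) iI) => u Iu.
by have h1 := hx Iu; have h2 := hw Iu; der; ring.
Qed.

Lemma plane_flow_homo s t : I s -> I t -> s <= t -> x s <= x t.
Proof.
move=> Is It st; apply: (interval_homo iI hx Is It st) => u _.
by rewrite mulr_ge0 ?sqr_ge0// mulr_ge0 ?ltW.
Qed.

(** A common bound for both variables, since [ext] takes only one; |w| <= 1 + w^2 avoids a square
    root. *)
Lemma plane_flow_bound (t X : R) : `|x t| <= X -> 0 <= X ->
  p * w t ^+ 2 <= X -> `|x t| <= X + (1 + X / p) /\ `|w t| <= X + (1 + X / p).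
Proof.
move=> h1 X0 h2; have Xp : 0 <= X / p by rewrite divr_ge0// ltW.
split; first by lra.
apply: (le_trans (norm_le_1Dsqr _)); rewrite addrCA lerD2l ler_wpDl//.
by rewrite ler_pdivlMr// mulrC.
Qed.

Section NegativeEnergy.
Variables t0 h : R.
Hypothesis It0 : I t0.
Hypothesis hE : x t0 ^+ 2 - p * w t0 ^+ 2 = h.
Hypothesis h0 : h < 0.

(** Energy conservation gives p w^2 = x^2 - h, so x' = r (x^2 - h). These are the blow-up hypotheses
    with K = 0 and c = 1/r. *)
Let speed t : I t -> - (r * h) <= r * p * w t ^+ 2 /\
  x t ^+ 2 <= 0 + r^-1 * (r * p * w t ^+ 2).
Proof.
move=> It; have e := plane_flow_energy It0 It.
have -> : r * p * w t ^+ 2 = r * (x t ^+ 2 - h).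
  by rewrite -mulrA; congr (_ * _); rewrite hE in e; lra.
rewrite add0r mulKf ?gt_eqF// -mulrN ler_pM2l//.
by have := sqr_ge0 (x t); have := h0; split; lra.
Qed.

Let rh0 : 0 < - (r * h). Proof. by rewrite oppr_gt0 pmulr_rlt0. Qed.
Let ri0 : 0 < r^-1. Proof. by rewrite invr_gt0. Qed.

Lemma negative_energy_bounded : has_ubound I /\ has_lbound I.
Proof.
split.
- by apply: (has_ubound_blowup iI hx It0 rh0 (lexx 0) ri0) => t /speed.
- by apply: (has_lbound_blowup iI hx It0 rh0 (lexx 0) ri0) => t /speed.
Qed.

Let bounded_side t Y : I t -> `|x t| <= Y ->
  let X := Y + Y ^+ 2 - h in
  `|x t| <= X + (1 + X / p) /\ `|w t| <= X + (1 + X / p).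
Proof.
move=> It xY X; have Y0 : 0 <= Y by exact: le_trans xY.
have xY2 : x t ^+ 2 <= Y ^+ 2.
  by rewrite -(real_normK (num_real (x t))) lerXn2r ?nnegrE.
have e := plane_flow_energy It0 It; rewrite hE in e.
by apply: plane_flow_bound; rewrite /X; have := sqr_ge0 Y; have := h0; lra.
Qed.

(** If x stayed above y, then before [t0] it would lie between y and [x t0]; by energy w would be
    bounded too, and steps of uniform length would make [I] unbounded below. The same holds above,
    and the intermediate value theorem concludes. *)
Lemma negative_energy_onto (y : R) : exists2 t, I t & x t = y.
Proof.
have [ub lb] := negative_energy_bounded.
have [[s Is sy]|nle] := pselect (exists2 s, I s & x s <= y); last first.
  exfalso; pose Y := `|x t0| + `|y|; pose X := Y + Y ^+ 2 - h.
  have [e e0 he] := ext (X + (1 + X / p)).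
  apply: (steps_unbounded_below e0 It0) lb => t It tt0.
  have [] := @bounded_side t Y It; last by move=> h1 h2; exact: he.
  have h1 := plane_flow_homo It It0 tt0.
  have h2 : y < x t by rewrite ltNge; apply/negP => ?; apply: nle; exists t.
  rewrite /Y ler_norml; have := ler_norm (x t0); have := ler_norm (- y).
  rewrite normrN; have := normr_ge0 y; have := normr_ge0 (x t0).
  by move=> ? ? ? ?; apply/andP; split; lra.
have [[t It yt]|nle] := pselect (exists2 t, I t & y <= x t); last first.
  exfalso; pose Y := `|x t0| + `|y|; pose X := Y + Y ^+ 2 - h.
  have [e e0 he] := ext (X + (1 + X / p)).
  apply: (steps_unbounded_above e0 It0) ub => t It tt0.
  have [] := @bounded_side t Y It; last by move=> h1 h2; exact: he.
  have h1 := plane_flow_homo It0 It tt0.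
  have h2 : x t < y by rewrite ltNge; apply/negP => ?; apply: nle; exists t.
  rewrite /Y ler_norml; have := ler_norm (- x t0); have := ler_norm y.
  rewrite normrN; have := normr_ge0 y; have := normr_ge0 (x t0).
  by move=> ? ? ? ?; apply/andP; split; lra.
apply: (interval_IVT iI _ Is It); last by rewrite sy.
by move=> u /hx; exact: der_continuous.
Qed.

Lemma negative_energy_slope (x1 : R) : x1 ^+ 2 < p -> exists2 t, I t & x t = x1 * w t.
Proof.
move=> x1p; have d0 : 0 < p - x1 ^+ 2 by rewrite subr_gt0.
(* The value of |w| that x = x1 w and energy h impose. Conversely, when x reaches x1 y0 or - x1 y0,
   according to the constant sign of w, the energy forces w = y0 or w = - y0. *)
pose y0 := Num.sqrt (- h / (p - x1 ^+ 2)).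
have q0 : 0 < - h / (p - x1 ^+ 2) by rewrite divr_gt0// oppr_gt0.
have y00 : 0 < y0 by rewrite sqrtr_gt0.
have y0E : (p - x1 ^+ 2) * y0 ^+ 2 = - h.
  by rewrite sqr_sqrtr ?ltW// mulrC divfK ?gt_eqF.
have cw t : I t -> {for t, continuous w} by move=> /hw; exact: der_continuous.
have sgw : (forall t, I t -> 0 < w t) \/ (forall t, I t -> w t < 0).
  have := w0 It0; rewrite neq_lt => /orP[wt0|wt0]; [right|left] => t It.
    rewrite -oppr_gt0; apply: (interval_sign (f := fun t => - w t) iI _ _ It0 It).
    - by move=> u Iu; exact: cvgN (cw u Iu).
    - by move=> u Iu; rewrite oppr_eq0 w0.
    - by rewrite oppr_gt0.
  exact: (interval_sign iI cw w0 It0 It).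
have wE t y : I t -> x t = x1 * y -> y ^+ 2 = y0 ^+ 2 -> w t ^+ 2 = y ^+ 2.
  move=> It xt yy; have e := plane_flow_energy It0 It; rewrite hE xt in e.
  by apply: (mulfI (lt0r_neq0 p0)); rewrite -yy in y0E; lra.
case: sgw => sgw.
- have [t It xt] := negative_energy_onto (x1 * y0); exists t => //.
  have : w t ^+ 2 = y0 ^+ 2 by exact: wE xt _.
  move/eqP; rewrite eqf_sqr => /orP[/eqP -> //|/eqP wt].
  by have := sgw t It; rewrite wt; lra.
- have [t It xt] := negative_energy_onto (x1 * - y0); exists t => //.
  have : w t ^+ 2 = (- y0) ^+ 2 by apply: wE xt _ => //; rewrite sqrrN.
  move/eqP; rewrite eqf_sqr opprK => /orP[/eqP -> //|/eqP wt].
  by have := sgw t It; rewrite wt; lra.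
Qed.

End NegativeEnergy.

(** At a zero of x the energy would be - p w^2 < 0. *)
Lemma nonneg_energy_neq0 t0 : I t0 -> 0 <= x t0 ^+ 2 - p * w t0 ^+ 2 ->
  forall t, I t -> x t != 0.
Proof.
move=> It0 h t It; rewrite (plane_flow_energy It0 It) in h.
apply: contraTneq h => ->; rewrite expr0n/= sub0r oppr_ge0 -ltNge.
by rewrite mulr_gt0// lt_neqAle eq_sym sqrf_eq0 w0// sqr_ge0.
Qed.

(** Towards the future x^2 grows, hence so does w^2, and x' stays above its value at [t0]: blow-up
    with K the energy and c = 1/r. Towards the past x lies between 0 and [x t0], so the state stays
    bounded. *)
Lemma nonneg_energy_pos t0 : I t0 -> 0 <= x t0 ^+ 2 - p * w t0 ^+ 2 ->
  0 < x t0 -> has_ubound I /\ ~ has_lbound I.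
Proof.
move=> It0 h xt0; have x_neq0 := nonneg_energy_neq0 It0 h.
have xpos t : I t -> 0 < x t.
  move=> It; apply: (interval_sign iI _ x_neq0 It0 It) => // u /hx.
  exact: der_continuous.
have w2 t : I t -> 0 < p * w t ^+ 2.
  by move=> It; rewrite mulr_gt0// lt_neqAle eq_sym sqrf_eq0 w0// sqr_ge0.
split.
- apply: (has_ubound_blowup (m := r * p * w t0 ^+ 2) iI hx It0 _ h
    (_ : 0 < r^-1)).
  + by rewrite -mulrA mulr_gt0// w2.
  + by rewrite invr_gt0.
  + move=> t It tt0; have e := plane_flow_energy It0 It.
    rewrite -!mulrA mulKf ?gt_eqF// ler_pM2l//.
    have xx : x t0 ^+ 2 <= x t ^+ 2.
      by rewrite lerXn2r ?nnegrE ?plane_flow_homo// ltW// xpos.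
    by split; lra.
- pose X := x t0 + x t0 ^+ 2.
  have [e e0 he] := ext (X + (1 + X / p)).
  apply: (steps_unbounded_below e0 It0) => t It tt0.
  have xle := plane_flow_homo It It0 tt0; have xt := xpos t It.
  have xx : x t ^+ 2 <= x t0 ^+ 2 by rewrite lerXn2r ?nnegrE// ltW.
  have en := plane_flow_energy It0 It; have := sqr_ge0 (x t0) => sq.
  have [] := @plane_flow_bound t X.
  + by rewrite /X gtr0_norm//; lra.
  + by rewrite /X; lra.
  + by rewrite /X; lra.
  + by move=> h1 h2; exact: he.
Qed.

End PlaneFlow.

(** The system is invariant under (t, x, w) -> (-t, -x, w), which reduces negative x to positive x
    and exchanges the two ends of [I]. *)
Lemma nonneg_energy_half {R : realType} (r p : R) (I : set R) (x w : R -> R) (t0 : R) :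
  0 < r -> 0 < p -> is_interval I ->
  (forall t, I t -> is_derive t 1 x (r * p * w t ^+ 2)) ->
  (forall t, I t -> is_derive t 1 w (r * x t * w t)) ->
  (forall t, I t -> w t != 0) ->
  (forall M : R, exists2 e : R, 0 < e & forall t0, I t0 ->
  `|x t0| <= M -> `|w t0| <= M -> forall s, `|s - t0| < e -> I s) ->
  I t0 -> 0 <= x t0 ^+ 2 - p * w t0 ^+ 2 ->
  has_ubound I /\ ~ has_lbound I \/ has_lbound I /\ ~ has_ubound I.
Proof.
move=> r0 p0 iI hx hw w0 ext It0 h.
have := nonneg_energy_neq0 p0 iI hx hw w0 It0 h It0.
rewrite neq_lt => /orP[xt0|xt0]; [right|left]; last first.
  exact: (nonneg_energy_pos r0 p0 iI hx hw w0 ext It0 h xt0).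
suff [/has_ubound_opp ? nl] : has_ubound (opp_set I) /\ ~ has_lbound (opp_set I).
  by split=> // ub; apply/nl/has_lbound_opp.
apply: (@nonneg_energy_pos _ r p _ (fun t => - x (- t)) (fun t => w (- t))
  r0 p0 (is_interval_opp iI) _ _ _ _ (- t0)).
- by move=> t It; rewrite -[X in is_derive _ _ _ X]opprK; apply/derN/der_opp/hx.
- move=> t It; have := der_opp (hw _ It).
  by move/der_eq; apply; ring.
- by move=> t /w0.
- move=> M; have [e e0 he] := ext M; exists e => // t It.
  rewrite normrN => h1 h2 s st; apply: (he (- t)) => //.
  by rewrite -opprD normrN.
- by rewrite /opp_set/= opprK.
- by rewrite opprK sqrrN.
- by rewrite opprK oppr_gt0.
Qed.

(** * The Lax field in eigenvector coordinates *)

Section LaxDynamics.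
Context {R : realType}.
Variables (a b : R).
Hypotheses (a_neq0 : a != 0) (b_gt0 : 0 < b).

Let r : R := Num.sqrt (a ^+ 2 + b ^+ 2).
Let rhoP : R := (- b - r) / a.
Let rhoQ : R := (- b + r) / a.

Lemma lax_r2 : r ^+ 2 = a ^+ 2 + b ^+ 2.
Proof. by rewrite sqr_sqrtr// addr_ge0// sqr_ge0. Qed.

Lemma lax_r_gt : b < r.
Proof.
have r0 : 0 <= r by exact: sqrtr_ge0.
rewrite -ltr_sqr ?nnegrE//; last exact: ltW.
by rewrite lax_r2 ltrDr lt_neqAle eq_sym sqrf_eq0 a_neq0 sqr_ge0.
Qed.

Lemma lax_r_gt0 : 0 < r. Proof. exact: lt_trans lax_r_gt. Qed.

(* Eigenvector equations of [[-b, a], [a, b]] for the eigenvalues -r and r. *)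
Lemma rhoPE : a * rhoP = - b - r /\ rhoP * (b - r) = a.
Proof.
have e : a * rhoP = - b - r by rewrite mulrC divfK.
by split=> //; apply: (mulfI a_neq0); rewrite mulrA e -expr2; have := lax_r2; lra.
Qed.

Lemma rhoQE : a * rhoQ = - b + r /\ rhoQ * (r + b) = a.
Proof.
have e : a * rhoQ = - b + r by rewrite mulrC divfK.
by split=> //; apply: (mulfI a_neq0); rewrite mulrA e -expr2; have := lax_r2; lra.
Qed.

(** The square of rho1, and the parameter p of the planar system on the plane V = 0. *)
Definition slope2 : R := 2 * b * (- b + r) / a ^+ 2.

Lemma slope2_gt0 : 0 < slope2.
Proof.
rewrite divr_gt0 ?exprn_even_gt0//= !mulr_gt0//.
by have := lax_r_gt; lra.
Qed.

(** On y = [rhoQ] w it brings the equation of x to the planar form. After multiplication by a^2 =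
    r^2 - b^2, both sides equal 2 b r (r - b). *)
Lemma slope2E : b * (rhoQ ^+ 2 + 1) = r * slope2.
Proof.
have a2 : a ^+ 2 != 0 by rewrite sqrf_eq0.
apply: (mulfI a2); rewrite [RHS]mulrCA /slope2 [X in r * X]mulrC divfK//.
have [e _] := rhoQE.
have -> : a ^+ 2 * (b * (rhoQ ^+ 2 + 1)) = b * ((a * rhoQ) ^+ 2 + a ^+ 2) by ring.
have -> : a ^+ 2 = r ^+ 2 - b ^+ 2 by have := lax_r2; lra.
by rewrite e; ring.
Qed.

Variables (I : set R) (x y w : R -> R).
Hypothesis iI : is_interval I.
Hypothesis hx : forall t, I t -> is_derive t 1 x (b * (y t ^+ 2 + w t ^+ 2)).
Hypothesis hy : forall t, I t -> is_derive t 1 y (x t * (a * w t - b * y t)).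
Hypothesis hw : forall t, I t -> is_derive t 1 w (x t * (a * y t + b * w t)).
Hypothesis ext : forall M : R, exists2 e : R, 0 < e & forall t0, I t0 ->
  `|x t0| <= M -> `|y t0| <= M -> `|w t0| <= M -> forall s, `|s - t0| < e -> I s.

Let U t := y t - rhoP * w t.
Let V t := y t - rhoQ * w t.

Let dU t : I t -> is_derive t 1 U (r * x t * U t).
Proof.
move=> It; have h2 := hy It; have h3 := hw It; have [e1 e2] := rhoPE.
apply: der_eq (derD h2 (derN (derM (der_cst rhoP t) h3))) _.
rewrite /U mulr0 addr0.
have -> : x t * (a * w t - b * y t) - rhoP * (x t * (a * y t + b * w t)) =
  x t * ((- b - a * rhoP) * y t + (a - rhoP * b) * w t) by ring.
have -> : a - rhoP * b = - (r * rhoP) by rewrite -{1}e2; ring.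
by rewrite e1; ring.
Qed.

Let dV t : I t -> is_derive t 1 V (- (r * x t) * V t).
Proof.
move=> It; have h2 := hy It; have h3 := hw It; have [e1 e2] := rhoQE.
apply: der_eq (derD h2 (derN (derM (der_cst rhoQ t) h3))) _.
rewrite /V mulr0 addr0.
have -> : x t * (a * w t - b * y t) - rhoQ * (x t * (a * y t + b * w t)) =
  x t * ((- b - a * rhoQ) * y t + (a - rhoQ * b) * w t) by ring.
have -> : a - rhoQ * b = r * rhoQ by rewrite -{1}e2; ring.
by rewrite e1; ring.
Qed.

Let cx t : I t -> {for t, continuous x}.
Proof. by move=> /hx; exact: der_continuous. Qed.

Lemma U_eq0 s t : I s -> I t -> U s = 0 -> U t = 0.
Proof.
apply: (linear_ode_eq0 iI dU) => u Iu.
by apply: cvgM; [exact: cvg_cst | exact: cx].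
Qed.

Lemma V_eq0 s t : I s -> I t -> V s = 0 -> V t = 0.
Proof.
apply: (linear_ode_eq0 iI dV) => u Iu.
by apply: cvgN; apply: cvgM; [exact: cvg_cst | exact: cx].
Qed.

(** Eigenvectors of a symmetric matrix are orthogonal, so the Euclidean norm is diagonal in U and V:
    the mixed term vanishes because [rhoQ * (r + b)] and [rhoP * (b - r)] both equal [a]. *)
Lemma UV_norm t : 2 * r * (y t ^+ 2 + w t ^+ 2) =
  (r - b) * U t ^+ 2 + (r + b) * V t ^+ 2.
Proof.
have [p1 p2] := rhoPE; have [q1 q2] := rhoQE.
have -> : (r - b) * U t ^+ 2 + (r + b) * V t ^+ 2 = 2 * r * y t ^+ 2
   - 2 * y t * w t * (rhoQ * (r + b) - rhoP * (b - r))
   + w t ^+ 2 * (rhoQ * (r + b) * rhoQ - rhoP * (b - r) * rhoP).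
  by rewrite /U /V; ring.
by rewrite p2 q2 p1 q1; ring.
Qed.

Lemma P_plane_complete : I !=set0 -> (forall t, I t -> U t = 0) -> I = setT.
Proof.
move=> [t0 It0] U0; have r0 := lax_r_gt0; have [e1 e2] := rhoPE.
have yE t : I t -> y t = rhoP * w t by move=> /U0/subr0_eq.
have hy' t : I t -> is_derive t 1 y (- r * x t * y t).
  move=> It; apply: der_eq (hy It) _; rewrite yE//.
  by rewrite -{1}e2; ring.
have hw' t : I t -> is_derive t 1 w (- r * x t * w t).
  move=> It; apply: der_eq (hw It) _; rewrite yE// [a * _]mulrA e1.
  by ring.
(* Constant because y and w both have logarithmic rate - r x on this plane; positive definite, so
   the state stays in a ball. *)
pose G t := r * x t ^+ 2 + b * (y t ^+ 2 + w t ^+ 2).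
have GE t : I t -> G t = G t0.
  move=> It; apply: (interval_const (f := G) iI _ It It0) => u Iu.
  have h1 := hx Iu; have h2 := hy' u Iu; have h3 := hw' u Iu.
  by rewrite /G; der; ring.
pose M := 1 + G t0 / r + G t0 / b.
have bounds t : I t -> [/\ `|x t| <= M, `|y t| <= M & `|w t| <= M].
  move=> It; have := GE t It; rewrite {1}/G => e.
  have x2 := sqr_ge0 (x t); have y2 := sqr_ge0 (y t); have w2 := sqr_ge0 (w t).
  have rx := mulr_ge0 (ltW r0) x2; have bby := mulr_ge0 (ltW b_gt0) y2.
  have bw := mulr_ge0 (ltW b_gt0) w2.
  have G0 : 0 <= G t0 by lra.
  have Gr : 0 <= G t0 / r by rewrite divr_ge0// ltW.
  have Gb : 0 <= G t0 / b by rewrite divr_ge0// ltW.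
  have hX : x t ^+ 2 <= G t0 / r by rewrite ler_pdivlMr// mulrC; lra.
  have hY : y t ^+ 2 <= G t0 / b by rewrite ler_pdivlMr// mulrC; lra.
  have hW : w t ^+ 2 <= G t0 / b by rewrite ler_pdivlMr// mulrC; lra.
  by split; apply: (le_trans (norm_le_1Dsqr _)); rewrite /M; lra.
have [e e0 he] := ext M.
apply: unbounded_interval_setT => //; first by exists t0.
- apply: (steps_unbounded_above e0 It0) => t It _.
  by have [? ? ?] := bounds t It; exact: he.
- apply: (steps_unbounded_below e0 It0) => t It _.
  by have [? ? ?] := bounds t It; exact: he.
Qed.

Lemma generic_bounded t0 : I t0 -> U t0 != 0 -> V t0 != 0 ->
  has_ubound I /\ has_lbound I.
Proof.
move=> It0 U0 V0; have r0 := lax_r_gt0; have rb := lax_r_gt; have bp := b_gt0.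
have r1 : 0 < r^-1 by rewrite invr_gt0.
pose c := U t0 * V t0.
have cE t : I t -> U t * V t = c.
  move=> It; apply: (interval_const (f := fun t => U t * V t) iI _ It It0) => u Iu.
  by have h1 := dU Iu; have h2 := dV Iu; der; ring.
pose T t := (r - b) * U t ^+ 2 - (r + b) * V t ^+ 2.
(* The derivative of T is 2 r x ((r - b) U^2 + (r + b) V^2), that is 4 r^2 x (y^2 + w^2) by
   [UV_norm]; this dictates the coefficients that make H constant. *)
pose H t := 2 * r ^+ 2 * x t ^+ 2 - b * T t.
have HE t : I t -> H t = H t0.
  move=> It; apply: (interval_const (f := H) iI _ It It0) => u Iu.
  have h1 := hx Iu; have h2 := dU Iu; have h3 := dV Iu.
  rewrite /H /T; der.
  transitivity (2 * r * b * x u * (2 * r * (y u ^+ 2 + w u ^+ 2)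
    - ((r - b) * U u ^+ 2 + (r + b) * V u ^+ 2))); first by ring.
  by rewrite UV_norm subrr mulr0.
pose K := `|H t0| / (2 * r ^+ 2).
have r2 : 0 < 2 * r ^+ 2 by rewrite mulr_gt0// exprn_gt0.
have K0 : 0 <= K by rewrite divr_ge0// ltW.
(* A lower bound for x', from U^2 + V^2 >= 2 |U V| and r - b being the smaller weight in
   [UV_norm]. *)
pose m := b * ((r - b) * (2 * `|c|) / (2 * r)).
have m0 : 0 < m.
  rewrite mulr_gt0// divr_gt0 ?mulr_gt0 ?subr_gt0//.
  by rewrite normr_gt0 mulf_neq0.
have rbp : 0 < r - b by rewrite subr_gt0.
have key t : I t -> m <= b * (y t ^+ 2 + w t ^+ 2) /\
    x t ^+ 2 <= K + r^-1 * (b * (y t ^+ 2 + w t ^+ 2)).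
  move=> It; have N := UV_norm t; have U2 := sqr_ge0 (U t).
  have V2 := sqr_ge0 (V t); split.
  - rewrite /m ler_pM2l// ler_pdivrMr ?mulr_gt0// [leRHS]mulrC N -(cE t It).
    apply: (@le_trans _ _ ((r - b) * (U t ^+ 2 + V t ^+ 2))).
      rewrite ler_pM2l// normrM -(real_normK (num_real (U t))).
      rewrite -(real_normK (num_real (V t))).
      by have := sqr_ge0 (`|U t| - `|V t|); lra.
    by have := mulr_ge0 (ltW bp) V2; lra.
  - rewrite -(ler_pM2l r2) mulrDr /K [2 * r ^+ 2 * (_ / _)]mulrC divfK ?gt_eqF//.
    have -> : 2 * r ^+ 2 * (r^-1 * (b * (y t ^+ 2 + w t ^+ 2))) =
              b * (2 * r * (y t ^+ 2 + w t ^+ 2)).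
      by field; rewrite gt_eqF.
    rewrite N; have := HE t It; rewrite {1}/H /T; have := ler_norm (H t0).
    have bV := mulr_ge0 (mulr_ge0 (ltW bp) (ltW (addr_gt0 r0 bp))) V2.
    by lra.
split.
- by apply: (has_ubound_blowup iI hx It0 m0 K0 r1) => t /key.
- by apply: (has_lbound_blowup iI hx It0 m0 K0 r1) => t /key.
Qed.

Section QPlane.
Hypothesis V0 : forall t, I t -> V t = 0.

Let yE t : I t -> y t = rhoQ * w t. Proof. by move=> /V0/subr0_eq. Qed.

Lemma Q_plane_x t : I t -> is_derive t 1 x (r * slope2 * w t ^+ 2).
Proof.
by move=> It; apply: der_eq (hx It) _; rewrite yE// -slope2E; ring.
Qed.

Lemma Q_plane_w t : I t -> is_derive t 1 w (r * x t * w t).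
Proof.
move=> It; have [e _] := rhoQE; apply: der_eq (hw It) _.
by rewrite yE// [a * _]mulrA e; ring.
Qed.

Lemma Q_plane_ext (M : R) : exists2 e : R, 0 < e & forall t0, I t0 ->
  `|x t0| <= M -> `|w t0| <= M -> forall s, `|s - t0| < e -> I s.
Proof.
have [e e0 he] := ext (`|M| + `|rhoQ| * `|M|); exists e => // t It xM wM.
have wM' := le_trans wM (ler_norm M); have xM' := le_trans xM (ler_norm M).
have q0 : 0 <= `|rhoQ| * `|M| by rewrite mulr_ge0.
apply: he => //; rewrite ?yE//.
- by apply: (le_trans xM'); rewrite lerDl.
- by rewrite normrM ler_wpDl// ler_wpM2l.
- by apply: (le_trans wM'); rewrite lerDl.
Qed.

(** On this plane a zero of w is a zero of y, hence of U, and zeros of U propagate along the whole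
    interval. *)
Lemma Q_plane_w_neq0 t0 : I t0 -> U t0 != 0 -> forall t, I t -> w t != 0.
Proof.
move=> It0 Ut0 t It; apply: contra Ut0 => /eqP wt.
apply/eqP; apply: (U_eq0 It It0).
by rewrite /U yE// wt !mulr0 subrr.
Qed.

End QPlane.

End LaxDynamics.

(** * Projection to RP(2) and the case distinction *)

Lemma rp2_pointZ (R : realType) (c : R) (v : 'rV[R]_3) : c != 0 ->
  rp2_point (c *: v) = rp2_point v.
Proof.
move=> c0; apply/eqP; rewrite eqEsubv -!memvE memvZ ?memv_line//=.
by rewrite -[X in X \in _](scalerK c0) memvZ// memv_line.
Qed.

(** Geodesics enter only through the uniform lifetime of solutions starting in a ball, which stands
    for maximality; the rest is dynamics of the Lax field. *)
Lemma lax_completeness (R : realType) (a b : R) (I : set R) (z : R -> 'rV[R]_3) :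
  a != 0 -> 0 < b -> is_interval I -> I !=set0 ->
  (forall t, I t -> forall i, is_derive t 1 (fun s => z s ord0 i)
    (lax_field a b (z t) ord0 i)) ->
  (forall M : R, exists2 e : R, 0 < e & forall t0, I t0 ->
    (forall i, `|z t0 ord0 i| <= M) -> forall s, `|s - t0| < e -> I s) ->
  let L := z @` I in
  let r : R := Num.sqrt (a ^+ 2 + b ^+ 2) in
  let P := [set z : 'rV[R]_3 | z2 z = (- b - r) / a * z3 z] in
  let rho2 : R := (- b + r) / a in
  let rho1 : R := Num.sqrt (2%:R * b * (- b + r)) / `|a| in
  let Q := [set z : 'rV[R]_3 | z2 z = rho2 * z3 z] in
  let segment := [set rp2_point (vec3 x1 rho2 1) | x1 in `]- rho1, rho1[] in
  [/\ L `<=` P -> geodesically_complete I,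
      ~ (L `<=` P) -> ~ geodesically_complete I &
      ~ geodesically_complete I ->
      (Rplus_complete I \/ Rminus_complete I <->
       L `<=` Q /\ rp2_point @` L <> segment)].
Proof.
move=> a_neq0 b_gt0 iI [s0 Is0] hz ext_z L r P rho2 rho1 Q segment.
have Lw : z @` I = L by [].
pose x t := z1 (z t); pose y t := z2 (z t); pose w t := z3 (z t).
have [hx hy hw] : [/\
    forall t, I t -> is_derive t 1 x (b * (y t ^+ 2 + w t ^+ 2)),
    forall t, I t -> is_derive t 1 y (x t * (a * w t - b * y t)) &
    forall t, I t -> is_derive t 1 w (x t * (a * y t + b * w t))].
  split=> t It.
  - by have := hz t It (inord 0); rewrite mxE inordK.
  - by have := hz t It (inord 1); rewrite mxE inordK.
  - by have := hz t It (inord 2); rewrite mxE inordK.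
have ext (M : R) : exists2 e : R, 0 < e & forall t0, I t0 ->
    `|x t0| <= M -> `|y t0| <= M -> `|w t0| <= M -> forall s, `|s - t0| < e -> I s.
  have [e e0 he] := ext_z M.
  by exists e => // t It ? ? ?; apply: he => //; elim/ord3_ind.
have LP t : I t -> L (z t) by move=> It; rewrite -Lw; exists t.
have r_gt0 : 0 < r := lax_r_gt0 a_neq0 b_gt0.
pose U t := y t - (- b - r) / a * w t; pose V t := y t - rho2 * w t.
have LPE : L `<=` P <-> forall t, I t -> U t = 0.
  split=> [h t It|h u]; first by
    apply/eqP; rewrite subr_eq0; apply/eqP; exact: h (LP t It).
  by rewrite -Lw => -[t It <-]; exact/subr0_eq/h.
have LQE : L `<=` Q <-> forall t, I t -> V t = 0.
  split=> [h t It|h u]; first by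
    apply/eqP; rewrite subr_eq0; apply/eqP; exact: h (LP t It).
  by rewrite -Lw => -[t It <-]; exact/subr0_eq/h.
have [U0|/existsNP[t0 /not_implyP[It0 Ut0]]] :=
    pselect (forall t, I t -> U t = 0).
  have IT := P_plane_complete a_neq0 b_gt0 iI hx hy hw ext (ex_intro _ _ Is0) U0.
  by split=> // /(_ (LPE.2 U0)).
have notP : ~ (L `<=` P) by move/LPE => /(_ _ It0).
have {}Ut0 : U t0 != 0 by exact/eqP.
have [Vt0|Vt0] := eqVneq (V t0) 0; last first.
  have [ub lb] := generic_bounded a_neq0 b_gt0 iI hx hy hw It0 Ut0 Vt0.
  split=> //; first by move=> _; exact: has_ubound_proper.
  move=> _; split; first by case=> /(_ _).
  by case=> /LQE /(_ _ It0) Vt0'; rewrite Vt0' eqxx in Vt0.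
have V0 t : I t -> V t = 0.
  by move=> It; exact: (V_eq0 a_neq0 iI hx hy hw It0 It Vt0).
have p0 := slope2_gt0 a_neq0 b_gt0.
have hx' := Q_plane_x a_neq0 hx V0.
have hw' := Q_plane_w a_neq0 hw V0.
have ext' := Q_plane_ext ext V0.
have w0 := Q_plane_w_neq0 a_neq0 iI hx hy hw V0 It0 Ut0.
have rho1_gt0 : 0 < rho1.
  rewrite divr_gt0 ?normr_gt0// sqrtr_gt0 !mulr_gt0//.
  by have := lax_r_gt a_neq0 b_gt0; rewrite -/r; lra.
have rho1E : rho1 ^+ 2 = slope2 a b.
  rewrite exprMn exprVn real_normK ?num_real// sqr_sqrtr//.
  rewrite !mulr_ge0 ?ltW//.
  by have := lax_r_gt a_neq0 b_gt0; rewrite -/r; lra.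
have rho1P x1 : (x1 \in `]- rho1, rho1[) = (x1 ^+ 2 < slope2 a b).
  rewrite in_itv/= -ltr_norml -rho1E -(real_normK (num_real x1)).
  by rewrite ltr_sqr ?nnegrE// ltW.
(* As w never vanishes, each projected point is normalised to third coordinate 1, with parameter x /
   w on the projective line of the plane. *)
have zE t : I t -> z t = w t *: vec3 (x t / w t) rho2 1.
  move=> It; have [e1 e2 e3] := z123_vec3 (x t / w t) rho2 1.
  apply: rV3P; [rewrite {2}/z1 mxE|rewrite {2}/z2 mxE|rewrite {2}/z3 mxE].
  - by rewrite -/(z1 _) e1 mulrC divfK ?w0.
  - by rewrite -/(z2 _) e2 mulrC; exact/subr0_eq/V0.
  - by rewrite -/(z3 _) e3 mulr1.
(* The energy is negative exactly when |x / w| < rho1, that is, when the projected point lies on the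
   segment. *)
case: (ltP (x t0 ^+ 2 - slope2 a b * w t0 ^+ 2) 0) => h0.
- have [ub lb] := negative_energy_bounded r_gt0 iI hx' hw' It0 erefl h0.
  split=> //; first by move=> _; exact: has_ubound_proper.
  move=> _; split; first by case=> /(_ _).
  case=> _ []; apply/seteqP; split=> [u [v + <-]|u [x1 + <-]].
  + rewrite -Lw => -[t It <-]; exists (x t / w t); last first.
      by rewrite (zE _ It) rp2_pointZ// w0.
    have e := plane_flow_energy iI hx' hw' It0 It.
    rewrite /= rho1P exprMn exprVn ltr_pdivrMr; first by lra.
    by rewrite lt_neqAle eq_sym sqrf_eq0 w0// sqr_ge0.
  + rewrite /= rho1P => x1p.
    have [t It xt] := negative_energy_slope r_gt0 p0 iI hx' hw' w0 ext' It0 erefl h0 x1p.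
    exists (z t); first exact: LP.
    by rewrite (zE _ It) rp2_pointZ ?w0// xt mulfK// w0.
- have half := nonneg_energy_half r_gt0 p0 iI hx' hw' w0 ext' It0 h0.
  have x_neq0 := nonneg_energy_neq0 p0 iI hx' hw' w0 It0 h0.
  split=> // [_|_].
    move=> IT; case: half => -[].
      by move=> ub _; exact: has_ubound_proper ub IT.
    move=> [l hl] _; have := hl (l - 1); rewrite IT => /(_ Logic.I); lra.
  split=> [_|_]; last by case: half => -[_ ?]; [right | left].
  split; first exact/LQE.
  (* The midpoint of the segment tells the two sets apart: x would vanish there, which nonnegative
     energy forbids. *)
  move=> eq_seg; have : segment (rp2_point (vec3 0 rho2 1)).
    by exists 0 => //=; rewrite rho1P expr0n.
  rewrite -eq_seg => -[v]; rewrite -Lw => -[t It <-] e.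
  have /vlineP[k zk] : z t \in <[vec3 0 rho2 1]>%VS.
    by rewrite -[<[_]>%VS]/(rp2_point _) -e memv_line.
  have := x_neq0 t It; rewrite /x zk {1}/z1 mxE -/(z1 _).
  by have [-> _ _] := z123_vec3 0 rho2 1; rewrite mulr0 eqxx.
Qed.

Theorem proposition8p2 (R : realType)
    (q : {biscalar (sl2 R)}) (hq : pseudo_euclidean q)
    (Phi : 'End(sl2 R)) (hPhi : associated_isomorphism q Phi)
    (hev : two_nonreal_eigenvalues Phi)
    (v1 v2 v3 : sl2 R) (eta gamma0 zeta : R)
    (hv : normal_basis Phi v1 v2 v3 eta gamma0 zeta)
    (D : {bilinear (sl2 R) -> (sl2 R) -> (sl2 R)}) (hD : levi_civita q D)
    (a b : R) (ha : a = gamma0 - eta) (hb : b = zeta)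
    (a_neq0 : a != 0) (b_gt0 : 0 < b)
    (L : set 'rV[R]_3) (hL : trajectory (lax_field a b) L) (hL0 : ~ L 0)
    (I : set R) (gamma : R -> 'M[R]_2)
    (hgamma : associated_geodesic D Phi v1 v2 v3 L I gamma) :
  let r : R := Num.sqrt (a ^+ 2 + b ^+ 2) in
  let P := [set z : 'rV[R]_3 | z2 z = (- b - r) / a * z3 z] in
  let rho2 : R := (- b + r) / a in
  let rho1 : R := Num.sqrt (2%:R * b * (- b + r)) / `|a| in
  let Q := [set z : 'rV[R]_3 | z2 z = rho2 * z3 z] in
  let segment := [set rp2_point (vec3 x1 rho2 1) | x1 in `]- rho1, rho1[] in
  [/\ L `<=` P -> geodesically_complete I,
      ~ (L `<=` P) -> ~ geodesically_complete I &
      ~ geodesically_complete I ->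
      (Rplus_complete I \/ Rminus_complete I <->
       L `<=` Q /\ rp2_point @` L <> segment)].
Proof.
(* [L] becomes the image of the curve [Phi (velocity gamma t)] in coordinates, and maximality of the
   geodesic supplies the uniform lifetime. *)
have [maxg <-] := hgamma; have [[oI gI] _] := maxg; have [I0 _ iI] := oI.
apply: lax_completeness => //.
- move=> t It; rewrite ha hb.
  by have [] := geodesic_flow hq hPhi hv hD (conj oI gI) It.
- by move=> M; exact: (maximal_geodesic_extends hq hPhi hv hD M maxg).
Qed.
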